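(* Let $y$ be a positive integer with $y\equiv 0\pmod 4$ and let $r,s\geq 0$ be integers. There exists a $(3,6)\text{-}\mathrm{HWP}(6y;r,s)$ if and only if $r+s=\frac{6y-2}{2}$, except possibly when $y=4$ or $y=8$. That is: if a $(3,6)\text{-}\mathrm{HWP}(6y;r,s)$ exists then $r+s=\frac{6y-2}{2}$; and if $r+s=\frac{6y-2}{2}$ and $y\notin\{4,8\}$, then a $(3,6)\text{-}\mathrm{HWP}(6y;r,s)$ exists.
   Context: A $C_m$-factor of a graph $G$ is a spanning subgraph of $G$ all of whose connected components are cycles of length $m$. A decomposition of a graph is a partition of its edge set into (edge sets of) subgraphs. For integers $m,n\ge 3$, $v\geq 1$ and $r,s\geq 0$, an $(m,n)\text{-}\mathrm{HWP}(v;r,s)$ is a decomposition of the complete graph $K_v$ if $v$ is odd, or of $K_v-F$ for some $1$-factor (perfect matching) $F$ of $K_v$ if $v$ is even, into $r$ $C_m$-factors and $s$ $C_n$-factors. *)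

(* Defs.v *)
From mathcomp Require Import all_boot.

Set Implicit Arguments.
Unset Strict Implicit.
Unset Printing Implicit Defensive.

(* A simple graph with vertex set the finite type T is given by its edge set,  *)
(* a set of two-element subsets of T; a spanning subgraph is then a subset of  *)
(* the edge set.                                                               *)

Section Graphs.

Variable T : finType.
Implicit Types (G H F : {set {set T}}) (C : {set T}).

Definition complete_graph : {set {set T}} := [set e : {set T} | #|e| == 2].

Definition adj H : rel T := [rel x y | (x != y) && ([set x; y] \in H)].

Definition component H (x : T) : {set T} := [set y | connect (adj H) x y].

Definition induced H C : {set {set T}} := [set e in H | e \subset C].

(* The graph with vertex set C and edge set E is a cycle of length m: c lists  *)
(* its vertices in cyclic order.                                               *)
Definition is_cycle (m : nat) C (E : {set {set T}}) : Prop :=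
  2 < m /\
  exists c : seq T,
    [/\ size c = m, uniq c, C = [set x in c]
      & E = [set [set x; next c x] | x in c]].

Definition cycle_factor (m : nat) G H : Prop :=
  H \subset G /\
  forall x : T, is_cycle m (component H x) (induced H (component H x)).

Definition one_factor G F : Prop :=
  F \subset G /\ forall x : T, #|[set e in F | x \in e]| = 1.

(* Sets of factors suffice: on a nonempty vertex set cycle factors have edges, *)
(* so edge-disjoint factors are distinct.                                      *)
Definition cycle_factorization (m n r s : nat) G : Prop :=
  exists A B : {set {set {set T}}},
    [/\ #|A| = r /\ #|B| = s, [disjoint A & B], partition (A :|: B) G,
        forall H, H \in A -> cycle_factor m G H
      & forall H, H \in B -> cycle_factor n G H].

End Graphs.

Definition HWP (m n v r s : nat) : Prop :=
  if odd v then cycle_factorization m n r s (complete_graph 'I_v)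
  else exists F : {set {set 'I_v}},
    one_factor (complete_graph 'I_v) F /\
    cycle_factorization m n r s (complete_graph 'I_v :\: F).

(* Main.v *)
(* Write y = 4k, so that the complete graph on 24k points minus a 1-factor has to be decomposed.
   A decomposition of the complete k-partite graph with groups of size 6 into triangle factors (a
   3-RGDD of type 6^k) is inflated by W = Z_2^2: a triangle factor, seen as a permutation f with
   3-cycles, yields one factor (x, u) |-> (f x, u + shift) for each w in W, where the shifts along
   a triangle are w, b w, c w for two permutations b, c of W.  The lifted cycle closes after three
   steps if w + b w + c w = 0 and after six otherwise, because W has exponent 2; suitable b and c
   give every number of C_6-factors but one.  The groups now have 24 points and are filled with a
   (3,6)-HWP(24; 11 - s, s) for s = 0, 1 or 11.

   For large k the 3-RGDD of type 6^k comes from a transversal design over Z_n with truncated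
   groups: its lines, of sizes 4 to 7, are replaced by Kirkman frames of type 6^u, and the holes
   together with one more group are filled with smaller 3-RGDDs.  The few values of k not reached
   in this way, 3, 7, 11, 15, 17, 19 and 23, use a 3-RGDD of type 3^k and W = Z_2^3 instead. *)
From HB Require Import structures.
From Stdlib Require Import NArith.
Require Import Defs.
From mathcomp Require Import all_boot all_algebra zify.

Set Implicit Arguments.
Unset Strict Implicit.
Unset Printing Implicit Defensive.

(** * Cycle factors as permutations *)

(** When all orbits have length at least 3, at most one of the two tests succeeds, so this is the
    indicator of an edge. Being a number, it can be summed over factors, and one identity then
    expresses disjointness and covering together. *)
Definition nadj (T : eqType) (f : T -> T) (x y : T) : nat := (f x == y) + (f y == x).

Definition orbits_of_size (T : eqType) (m : nat) (f : T -> T) : Prop :=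
  forall x, iter m f x = x /\ forall j, 0 < j < m -> iter j f x != x.

Definition edges (T : finType) (f : T -> T) : {set {set T}} :=
  [set [set x; f x] | x : T].

Lemma set2_eq (T : finType) (a b c d : T) :
  ([set a; b] == [set c; d]) = ((a == c) && (b == d)) || ((a == d) && (b == c)).
Proof.
apply/eqP/idP => [E | /orP[] /andP[/eqP-> /eqP->] //]; last by rewrite setUC.
have Ha : a \in [set c; d] by rewrite -E set21.
have Hb : b \in [set c; d] by rewrite -E set22.
have Hc : c \in [set a; b] by rewrite E set21.
have Hd : d \in [set a; b] by rewrite E set22.
move: Ha Hb Hc Hd; rewrite !inE (eq_sym c a) (eq_sym c b) (eq_sym d a) (eq_sym d b).
by case: (a == c); case: (b == d); case: (a == d); case: (b == c).
Qed.

Lemma mem_edges (T : finType) (f : T -> T) (x y : T) :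
  ([set x; y] \in edges f) = (0 < nadj f x y).
Proof.
apply/imsetP/idP => [[z _ /eqP] | ].
  rewrite set2_eq /nadj => /orP[] /andP[/eqP-> /eqP->]; first by rewrite eqxx.
  by rewrite eqxx addnC.
rewrite /nadj; case: eqP => [<- _ | _]; first by exists x.
by case: eqP => [<- _ | //]; exists y => //; rewrite setUC.
Qed.

Section OrbitFactor.

Variables (T : finType) (m : nat) (f : T -> T).
Hypotheses (m_gt2 : 2 < m) (fm : orbits_of_size m f).

Lemma orbits_inj : injective f.
Proof.
move=> x y E; rewrite -(proj1 (fm x)) -(proj1 (fm y)).
by case: m m_gt2 => // n _; rewrite !iterSr E.
Qed.

Lemma orbits_neq x : f x != x.
Proof. by apply: (proj2 (fm x) 1); rewrite /= (ltn_trans _ m_gt2). Qed.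

Lemma order_orbits x : order f x = m.
Proof.
have [Em Hm] := fm x.
have ox : iter (order f x) f x = x by apply: iter_order; apply: orbits_inj.
have le : m <= order f x.
  rewrite leqNgt; apply/negP => lt.
  by move: (Hm (order f x)); rewrite order_gt0 lt ox eqxx => /(_ isT).
apply/eqP; rewrite eqn_leq le andbT leqNgt; apply/negP => lt.
have := findex_iter lt; rewrite Em.
have -> : findex f x x = 0 by rewrite findex0.
by move=> E; move: m_gt2; rewrite -E.
Qed.

(** The connected components are the orbits of [f], and [orbit f x] lists one of them in cyclic
    order. *)
Lemma edges_cycle_factor (G : {set {set T}}) :
  edges f \subset G -> cycle_factor m G (edges f).
Proof.
move=> sub; split=> // x.
have adjE y z : adj (edges f) y z = (f y == z) || (f z == y).
  rewrite /adj /= mem_edges /nadj.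
  have -> : (0 < (f y == z) + (f z == y)) = (f y == z) || (f z == y).
    by case: eqP; case: eqP.
  case: eqVneq => [-> | _] /=; last by [].
  by rewrite (negPf (orbits_neq z)).
have symf := fconnect_sym orbits_inj.
have comp : component (edges f) x = [set y in orbit f x].
  apply/setP=> y; rewrite !inE -fconnect_orbit; apply/idP/idP.
    apply: connect_sub y => a b; rewrite adjE => /orP[] /eqP <-.
      exact: fconnect1.
    by rewrite symf fconnect1.
  apply: connect_sub y => a b /eqP <-; apply: connect1.
  by rewrite adjE eqxx.
split=> //; exists (orbit f x); split.
- by rewrite size_orbit order_orbits.
- exact: orbit_uniq.
- exact: comp.
have nextf y : y \in orbit f x -> next (orbit f x) y = f y.
  by move/(next_cycle (cycle_orbit orbits_inj x)) => /eqP.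
apply/setP => e; rewrite comp /induced inE; apply/andP/imsetP.
  case=> /imsetP[y _ ->] /subsetP /(_ y); rewrite set21 => /(_ isT); rewrite inE => Hy.
  by exists y => //; rewrite nextf.
case=> y Hy ->; rewrite nextf //; split; first by apply/imsetP; exists y.
have Hy' : f y \in orbit f x.
  by rewrite -fconnect_orbit (connect_trans _ (fconnect1 f y)) // fconnect_orbit.
by apply/subsetP=> z; rewrite !inE => /orP[] /eqP ->.
Qed.

End OrbitFactor.

(** The edges at [x] are those to its successor and to its predecessor on the cycle through [x]. *)
Lemma cycle_factor_degree (T : finType) m (G H : {set {set T}}) (x : T) :
  G \subset complete_graph T -> cycle_factor m G H -> #|[set e in H | x \in e]| = 2.
Proof.
move=> subG [subH /(_ x) [m_gt2 [c [szc uc Ec EE]]]].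
have xC : x \in component H x by rewrite inE connect0.
have xc : x \in c by move: xC; rewrite Ec inE.
have -> : [set e in H | x \in e] = [set [set x; next c x]; [set prev c x; x]].
  apply/setP => e; rewrite !inE; apply/andP/orP.
    case=> eH xe; have: e \in induced H (component H x).
      rewrite inE eH /=; apply/subsetP=> y ye.
      case: (eqVneq x y) => [<- //|nxy].
      have e2 : #|e| == 2 by have := subsetP subG _ (subsetP subH _ eH); rewrite inE.
      have Ee : e = [set x; y].
        apply/eqP; rewrite eq_sym eqEcard (eqP e2) cards2 nxy andbT.
        by apply/subsetP=> z; rewrite !inE => /orP[] /eqP ->.
      by rewrite inE connect1 //= /adj /= nxy -Ee.
    rewrite EE => /imsetP[y yc Ey]; move: xe; rewrite Ey !inE => /orP[/eqP<-|/eqP xn].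
      by left.
    by right; rewrite xn prev_next.
  have sub : induced H (component H x) \subset H by apply/subsetP=> z; rewrite inE => /andP[].
  case=> /eqP ->; split; rewrite ?set21 ?set22 //; apply: (subsetP sub); rewrite EE; apply/imsetP.
    by exists x.
  by exists (prev c x); rewrite ?mem_prev // next_prev.
rewrite cards2 set2_eq eqxx.
(* After a rotation that puts [x] first, the successor is the second entry and the predecessor the
   last one; a third entry exists because [m > 2]. *)
have npx : next c x != prev c x.
  case/rot_to: (xc) => i c' Ec'; rewrite -(next_rot i uc) -(prev_rot i uc) Ec'.
  have: uniq (x :: c') by rewrite -Ec' rot_uniq.
  have: size (x :: c') = m by rewrite -Ec' size_rot.
  case: c' Ec' => [|y [|z c']] Ec'; [by move=> /= Em; move: m_gt2; rewrite -Em..|].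
  move=> _ uxc; rewrite next_nth prev_nth !mem_head /= eqxx.
  move: uxc; rewrite /= !inE => /and3P[]; rewrite !negb_or => /and3P[xy xz xc'] /andP[yz yc'] _.
  rewrite eq_sym in xy; rewrite (eq_sym z) (negPf xz) (negPf xy) (memNindex xc') /=.
  rewrite -[size c']/((size (z :: c')).-1) nth_last /=.
  by apply/eqP => E; move: (mem_last z c'); rewrite -E inE (negPf yz) (negPf yc').
rewrite (negPf npx) orbF; case: (x =P prev c x) => [Ex|//] /=.
by rewrite {2}Ex (negPf npx).
Qed.

(** The problem in terms of permutations. Only the number of hexagon factors is recorded, since a
    degree count determines the number of triangle factors. The matching [F] is counted by one test
    because [nadj] would count each of its edges twice. *)
Definition hw_decomposable (T : finType) (s : nat) : Prop :=
  exists (F : T -> T) (I : finType) (hex : pred I) (f : I -> T -> T),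
    [/\ orbits_of_size 2 F,
        forall i, orbits_of_size (if hex i then 6 else 3) (f i),
        forall x y, (F x == y) + \sum_i nadj (f i) x y = (x != y)
      & #|hex| = s].

Lemma eq_card_bij (T T' : finType) :
  #|T| = #|T'| -> exists (h : T -> T') (h' : T' -> T), cancel h h' /\ cancel h' h.
Proof.
move=> eqT; exists (fun x => enum_val (cast_ord eqT (enum_rank x))).
exists (fun y => enum_val (cast_ord (esym eqT) (enum_rank y))).
by split=> x; rewrite enum_valK ?cast_ordK ?cast_ordKV enum_rankK.
Qed.

Section Conjugation.

Variables (T T' : eqType) (h : T -> T') (h' : T' -> T).
Hypotheses (hK : cancel h h') (h'K : cancel h' h).

Definition conjf (f : T -> T) (y : T') : T' := h (f (h' y)).

Lemma conjf_eq f x y : (conjf f x == y) = (f (h' x) == h' y).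
Proof. by rewrite -(inj_eq (can_inj h'K)) hK. Qed.

Lemma nadj_conjf f x y : nadj (conjf f) x y = nadj f (h' x) (h' y).
Proof. by rewrite /nadj !conjf_eq. Qed.

Lemma iter_conjf f n x : iter n (conjf f) x = h (iter n f (h' x)).
Proof. by elim: n => [|n IHn] /=; rewrite ?h'K // IHn /conjf hK. Qed.

Lemma orbits_conjf m f : orbits_of_size m f -> orbits_of_size m (conjf f).
Proof.
move=> fm y; have [E H] := fm (h' y); split=> [|j /H nE]; rewrite iter_conjf ?E //.
by apply: contra nE => /eqP {2}<-; rewrite hK.
Qed.

End Conjugation.

Lemma hw_decomposable_card (T T' : finType) s :
  #|T| = #|T'| -> hw_decomposable T s -> hw_decomposable T' s.
Proof.
move=> /eq_card_bij[h [h' [hK h'K]]] [F [I [hex [f [FF ff sumf hexs]]]]].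
exists (conjf h h' F), I, hex, (fun i => conjf h h' (f i)); split=> //.
- exact: orbits_conjf.
- by move=> i; apply: orbits_conjf.
- move=> x y; rewrite conjf_eq //.
  under eq_bigr do rewrite nadj_conjf //.
  by rewrite sumf (inj_eq (can_inj h'K)).
Qed.

Lemma sum_nadj_nbr (T : finType) m (f : T -> T) x :
  2 < m -> orbits_of_size m f -> \sum_y nadj f x y = 2.
Proof.
move=> m_gt2 fm; rewrite big_split /= (bigD1 (f x)) //= eqxx big1; last first.
  by move=> y /negPf; rewrite eq_sym => ->.
have fi := orbits_inj m_gt2 fm.
rewrite (bigD1 (finv f x)) //= f_finv // eqxx big1 // => y.
by rewrite -(inj_eq fi) f_finv // => /negPf ->.
Qed.

(** The sum identity makes the edge sets of the factors disjoint and covering. Different indices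
    give different edge sets because every factor has an edge at [x0]. *)
Lemma hw_decomposable_HWP (v r s : nat) :
  0 < v -> ~~ odd v -> r + s = (v - 2) %/ 2 ->
  hw_decomposable 'I_v s -> HWP 3 6 v r s.
Proof.
move=> v_gt0 v_even rs [F [I [hex [f [FF ff sumf hexs]]]]].
rewrite /HWP (negPf v_even).
have m_gt2 i : 2 < if hex i then 6 else 3 by case: (hex i).
have x0 : 'I_v := Ordinal v_gt0.
(* Neighbours of [x0] are counted: one through [F] and two through every factor, [v - 1] in all. *)
have cardI : #|I| = r + s.
  have: \sum_y ((F x0 == y) + \sum_i nadj (f i) x0 y) = v.-1.
    rewrite (eq_bigr (fun y => (x0 != y) : nat)); last by move=> y _; rewrite sumf.
    rewrite (bigD1 x0) //= eqxx add0n (eq_bigr (fun=> 1)); last first.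
      by move=> y; rewrite eq_sym => ->.
    by rewrite sum1_card cardC1 card_ord.
  rewrite big_split /= (bigD1 (F x0)) //= eqxx big1 ?addn0; last first.
    by move=> y; rewrite eq_sym => /negPf ->.
  rewrite exchange_big /= (eq_bigr (fun=> 2)); last first.
    by move=> i _; apply: sum_nadj_nbr (m_gt2 i) (ff i).
  by rewrite sum_nat_const rs; set c := #|I|; lia.
have Fneq x : F x != x := proj2 (FF x) 1 isT.
have FK x : F (F x) = x := proj1 (FF x).
have FE x y : [set x; y] \in edges F = (F x == y).
  rewrite mem_edges /nadj; have -> : (F y == x) = (F x == y).
    by rewrite -(inj_eq (can_inj FK)) FK eq_sym.
  by case: eqP.
have disj i j e : e \in edges (f i) -> e \in edges (f j) -> i = j.
  case/imsetP=> x _ ->; rewrite !mem_edges => H; case: (eqVneq i j) => // nij.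
  have := sumf x (f i x); rewrite (bigD1 i) //= (bigD1 j) 1?eq_sym //=.
  have : 0 < nadj (f i) x (f i x) by rewrite /nadj eqxx.
  by case: (x != _) => /=; lia.
have subG i : edges (f i) \subset complete_graph 'I_v :\: edges F.
  apply/subsetP=> e /imsetP[x _ ->]; rewrite inE FE inE cards2.
  have := sumf x (f i x); rewrite (bigD1 i) //=.
  have : 0 < nadj (f i) x (f i x) by rewrite /nadj eqxx.
  by case: (F x == _) => /=; case: (x != _) => //=; lia.
have einj : injective (fun i => edges (f i)).
  move=> i j E; apply: (disj i j [set x0; f i x0]); first by apply/imsetP; exists x0.
  by rewrite -E; apply/imsetP; exists x0.
exists (edges F); split.
  split=> [|x].
    by apply/subsetP=> e /imsetP[x _ ->]; rewrite inE cards2 (eq_sym x) Fneq.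
  rewrite (_ : [set e in _ | _] = [set [set x; F x]]) ?cards1 //.
  apply/setP=> e; rewrite !inE; apply/andP/eqP => [[] | ->].
    by case/imsetP=> y _ ->; rewrite !inE => /orP[] /eqP -> //; rewrite FK setUC.
  by rewrite set21 FE.
exists [set edges (f i) | i in [pred i | ~~ hex i]], [set edges (f i) | i in hex].
split.
- rewrite !card_imset // hexs; split=> //.
  have := cardC hex; rewrite cardI hexs => E.
  by apply/eqP; rewrite -(eqn_add2r s) -E addnC.
- rewrite -setI_eq0; apply/eqP/setP=> H; rewrite !inE; apply/negP=> /andP[].
  by case/imsetP=> i ni -> /imsetP[j hj /einj Ej]; move: ni; rewrite inE Ej => /negP; apply.
- set AB := (_ :|: _); have {AB}-> : AB = [set edges (f i) | i in I].
    apply/setP=> H; rewrite inE; apply/orP/imsetP=> [|[i _ ->]].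
      by case=> /imsetP[i _ ->]; exists i.
    by case hi: (hex i); [right | left]; apply: imset_f; rewrite ?inE ?hi.
  apply/and3P; split.
  + apply/eqP/setP=> e; apply/bigcupP/idP.
      by case=> H /imsetP[i _ ->]; apply: (subsetP (subG i)).
    case/setDP; rewrite inE => /cards2P[x [y [nxy Ee]]] nF.
    have := sumf x y; rewrite nxy -FE -Ee (negPf nF) add0n => sum1.
    have [i Hi] : exists i, 0 < nadj (f i) x y.
      apply/existsP; rewrite -[[exists i, _]]negbK negb_exists; apply/negP => /forallP H.
      move: sum1; rewrite big1 // => i _; apply/eqP; by rewrite -leqn0 leqNgt H.
    exists (edges (f i)); last by rewrite Ee mem_edges.
    exact: imset_f.
  + apply/trivIsetP=> A B /imsetP[i _ ->] /imsetP[j _ ->] nij.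
    rewrite -setI_eq0; apply/eqP/setP=> e; rewrite !inE; apply/negP=> /andP[ei ej].
    by move: nij; rewrite (disj _ _ _ ei ej) eqxx.
  + apply/negP=> /imsetP[i _ E].
    have: [set x0; f i x0] \in edges (f i) by apply/imsetP; exists x0.
    by rewrite -E inE.
- move=> H /imsetP[i ni ->]; apply: edges_cycle_factor => //.
  by have := ff i; rewrite (negPf ni).
- move=> H /imsetP[i hi ->]; apply: edges_cycle_factor => //.
  by have := ff i; rewrite (_ : hex i = true).
Qed.

(** Of the [v - 1] edges at a vertex, the 1-factor takes one and each of the [r + s] cycle factors
    takes two. *)
Lemma HWP_count (v r s m n : nat) :
  0 < v -> ~~ odd v -> HWP m n v r s -> r + s = (v - 2) %/ 2.
Proof.
move=> v_gt0 v_even; rewrite /HWP (negPf v_even).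
case=> F [[subF F1] [A [B [[cA cB] dAB part fA fB]]]].
have x0 : 'I_v := Ordinal v_gt0.
pose G := complete_graph 'I_v :\: F; pose st (H : {set {set 'I_v}}) := [set e in H | x0 \in e].
have subG : G \subset complete_graph 'I_v by apply: subsetDl.
have stAB H : H \in A :|: B -> #|st H| = 2.
  by rewrite inE => /orP[/fA|/fB]; apply: cycle_factor_degree.
have stK : #|st (complete_graph 'I_v)| = v.-1.
  rewrite -[in RHS](card_ord v) -(cardC1 x0) -(card_in_imset (f := fun y => [set x0; y])).
    apply: eq_card => e; rewrite !inE; apply/andP/imsetP.
      case=> /cards2P[x [y [nxy ->]]]; rewrite !inE => /orP[] /eqP E; subst.
        by exists y; rewrite // !inE eq_sym.
      by exists x; rewrite // 1?setUC // !inE.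
    by case=> y; rewrite !inE => ny ->; rewrite cards2 (eq_sym x0) ny set21.
  move=> y z ny nz /eqP; rewrite set2_eq eqxx => /orP[/eqP //|].
  by case/andP=> /eqP Ez; move: nz; rewrite !inE -Ez eqxx.
have stG : #|st G| = v.-2.
  have : #|st (complete_graph 'I_v) :\: st F| = v.-1 - 1.
    rewrite cardsD (setIidPr _) ?stK ?F1 //.
    by apply/subsetP=> e; rewrite !inE => /andP[/(subsetP subF)]; rewrite inE => -> ->.
  rewrite subn1 => <-; apply: eq_card => e; rewrite !inE.
  by case: (e \in F); case: (x0 \in e); rewrite ?andbF ?andbT.
have : #|st G| = (r + s).*2.
  rewrite -sum1_card (eq_bigl (fun e => (e \in G) && (x0 \in e))); last first.
    by move=> e; rewrite inE.
  rewrite big_mkcondr -[G](cover_partition part) big_trivIset; last by case/and3P: part.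
  rewrite (eq_bigr (fun=> 2)) => [|H HH]; last first.
    rewrite -big_mkcondr -[RHS](stAB H HH) -sum1_card.
    by apply: eq_bigl => e; rewrite inE.
  rewrite sum_nat_const cardsU (eqP (_ : A :&: B == set0)) ?setI_eq0 //.
  by rewrite cards0 cA cB; lia.
by rewrite stG; lia.
Qed.

(** * Inflating triangle factors *)

Import GRing.Theory.

Definition triangle_decomposition (T I : finType) (e : rel T) (f : I -> T -> T) : Prop :=
  (forall i, orbits_of_size 3 (f i)) /\ forall x y, \sum_i nadj (f i) x y = e x y.

Lemma orbits3P (T : eqType) (f : T -> T) :
  (forall x, f (f (f x)) = x) -> (forall x, f x != x) -> orbits_of_size 3 f.
Proof.
move=> f3 f1 x; split=> [|j]; first exact: f3.
case: j => [|[|[|j]]] //= _.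
by have := f1 (f (f x)); rewrite f3 eq_sym.
Qed.

(** The lift needs a starting point on every 3-cycle; the point of smallest enumeration rank is
    taken, and [l] is the position counted from it along [f]. *)
Lemma orbit3_level (T : finType) (f : T -> T) :
  orbits_of_size 3 f ->
  exists l : T -> nat, forall x, l x < 3 /\ l (f x) = (l x).+1 %% 3.
Proof.
move=> f3; pose r (x : T) : nat := enum_rank x.
exists (fun x => if (r x < r (f x)) && (r x < r (f (f x))) then 0
  else if (r (f (f x)) < r x) && (r (f (f x)) < r (f x)) then 1 else 2).
move=> x; have [E H] := f3 x; have H1 := H 1 isT; have H2 := H 2 isT.
have H3 := proj2 (f3 (f x)) 1 isT; rewrite /= in E H1 H2 H3; rewrite E.
have re (y z : T) : y != z -> r y <> r z.
  by move/eqP=> nyz /ord_inj /enum_rank_inj.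
move/re: H1 => H1; move/re: H2 => H2; move/re: H3 => H3.
by case: ifP => c1; case: ifP => c2; rewrite ?c1 ?c2; do ?case: ifP => ?; lia.
Qed.

Section Lift.

Variables (W : finZmodType).

(** Here [w], [b w], [c w] are the shifts on the three arcs of a triangle. Injectivity lets every
    shift occur once on each arc as [w] varies, the doubling condition closes each lifted cycle
    after six steps, and [s] counts the [w] that yield hexagons. *)
Definition liftable (s : nat) : Prop := exists b c : W -> W,
  [/\ injective b, injective c, forall w, (w + b w + c w) *+ 2 = 0
    & #|[pred w | w + b w + c w != 0]| = s]%R.

Definition shift3 (b c : W -> W) (w : W) (l : nat) : W :=
  if l == 0 then w else if l == 1 then b w else c w.

Lemma lift_triangle_decomposition (T I : finType) (e : rel T) (f : I -> T -> T)
    (s : I -> nat) :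
  triangle_decomposition e f -> (forall i, liftable (s i)) ->
  exists (J : finType) (hex : pred J) (g : J -> T * W -> T * W),
    [/\ forall j, orbits_of_size (if hex j then 6 else 3) (g j),
        forall x y, \sum_j nadj (g j) x y = e x.1 y.1,
        #|J| = #|I| * #|W|
      & #|hex| = \sum_i s i].
Proof.
move=> [f3 sumf] /fin_all_exists[b /fin_all_exists[c bc]].
have /fin_all_exists[l lP] := fun i => orbit3_level (f3 i).
pose S i w : W := (w + b i w + c i w)%R.
pose g (j : I * W) (x : T * W) : T * W :=
  (f j.1 x.1, x.2 + shift3 (b j.1) (c j.1) j.2 (l j.1 x.1))%R.
exists (I * W)%type, (fun j => S j.1 j.2 != 0%R), g.
have inj_shift i k : injective (fun w => shift3 (b i) (c i) w k).
  have [bi ci _ _] := bc i; rewrite /shift3.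
  by case: (k == 0) => [x y //|]; case: (k == 1).
have iter1 n i w p u : (iter n (g (i, w)) (p, u)).1 = iter n (f i) p.
  by elim: n => //= n ->.
(* Three steps go once round the triangle and add all three shifts, whatever the starting
   position. *)
have iter3 i w p u : iter 3 (g (i, w)) (p, u) = (p, u + S i w)%R.
  have [fp _] := f3 i p; have [lt1 l1] := lP i p; have [lt2 l2] := lP i (f i p).
  rewrite /= in fp; rewrite /= /g /= fp l2 l1; congr pair; rewrite /S /shift3.
  case: (l i p) lt1 => [|[|[|//]]] _ /=;
    rewrite -!addrA; congr (_ + _)%R.
  - by rewrite [RHS]addrC !addrA.
  - by rewrite [LHS]addrC !addrA.
split.
- move=> [i w] [p u] /=; have [bi ci S2 _] := bc i.
  have [Ef Hf] := f3 i p.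
  have neq j : iter j (f i) p != p -> iter j (g (i, w)) (p, u) != (p, u).
    by apply: contra => /eqP E; rewrite -(iter1 j i w p u) E.
  case: ifP => [S0 | /negbFE/eqP S0]; split.
  + by rewrite (iterD 3 3) !iter3 -addrA -mulr2n S2 addr0.
  + move=> j Hj; case: (ltngtP j 3) => [lt|gt|->].
    * by apply/neq/Hf; lia.
    * have -> : j = (j - 3) + 3 by lia.
      by apply: neq; rewrite iterD Ef; apply: Hf; lia.
    * rewrite iter3; apply: contra S0 => /eqP[] /eqP.
      by rewrite -subr_eq0 addrC addKr.
  + by rewrite iter3 S0 addr0.
  + by move=> j /Hf /neq.
- move=> [p u] [q v] /=; rewrite -sumf.
  (* Over an arc of [f i], exactly one [w] produces the required difference of second coordinates,
     because an injective map of the finite set [W] to itself is onto. *)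
  have half i (x y : T * W) : \sum_(w : W) (g (i, w) x == y : nat) = (f i x.1 == y.1).
    case: x y => [x1 x2] [y1 y2] /=.
    under eq_bigr => w _ do rewrite /g xpair_eqE /= -mulnb.
    rewrite -big_distrr /=; case: eqP => //= _; rewrite mul1n.
    have /codomP[w Ew] : (y2 - x2)%R \in codom (fun w => shift3 (b i) (c i) w (l i x1)).
      by apply: inj_card_onto => //.
    rewrite (bigD1 w) //= -Ew addrC subrK eqxx big1 // => w' nw.
    apply/eqP; rewrite eqb0; apply: contra nw => /eqP E.
    by apply/eqP/(inj_shift i (l i x1)); rewrite -Ew -E addrC addKr.
  rewrite -(pair_bigA _ (fun i w => nadj (g (i, w)) (p, u) (q, v))) /=.
  by apply: eq_bigr => i _; rewrite big_split /= !half.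
- by rewrite card_prod.
- rewrite -sum1_card big_mkcond -(pair_bigA _ (fun i w => if S i w != 0%R then 1 else 0)) /=.
  apply: eq_bigr => i _; have [_ _ _ <-] := bc i.
  by rewrite -big_mkcond sum1_card.
Qed.

End Lift.

(** * Shift permutations for elementary abelian groups of order 4 and 8 *)

HB.instance Definition _ (V W : finZmodType) := GRing.Zmodule.on (V * W)%type.

(** The value 1 is out of reach for the two groups used: their elements sum to 0, hence so do the
    values [w + b w + c w], and a single one of them cannot be nonzero. *)
Definition liftable_spectrum (W : finZmodType) : Prop :=
  forall s, s <= #|W| -> s != 1 -> liftable W s.

(** Elements are coded by binary numbers; [t] lists the codes of the images. The same coding serves
    in [cube_fun]. *)
Definition klein_fun (t : seq nat) (w : bool * bool) : bool * bool :=
  let k := nth 0 t (w.1.*2 + w.2) in (odd k./2, odd k).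

Definition cube_fun (t : seq nat) (w : bool * bool * bool) : bool * bool * bool :=
  let k := nth 0 t (w.1.1.*2.*2 + w.1.2.*2 + w.2) in (odd k./2./2, odd k./2, odd k).

Lemma card_klein (P : pred (bool * bool)) :
  #|P| = P (true, true) + P (true, false) + (P (false, true) + P (false, false)).
Proof.
rewrite -sum1_card big_mkcond (eq_bigr (fun w => P (w.1, w.2) : nat)) => [|[a b] _]; last first.
  by rewrite unfold_in /=; case: (P _).
by rewrite -(pair_bigA _ (fun a b => P (a, b) : nat)) /= !big_bool.
Qed.

Lemma card_cube (P : pred (bool * bool * bool)) :
  #|P| = #|[pred w | P (w, true)]| + #|[pred w | P (w, false)]|.
Proof.
rewrite -sum1_card big_mkcond (eq_bigr (fun w => P (w.1, w.2) : nat)) => [|[a b] _]; last first.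
  by rewrite unfold_in /=; case: (P _).
rewrite -(pair_bigA _ (fun a b => P (a, b) : nat)) /= exchange_big /= big_bool.
by congr (_ + _); rewrite -sum1_card [RHS]big_mkcond; apply: eq_bigr => w _;
  rewrite unfold_in /=; case: (P _).
Qed.

Lemma liftable_klein : liftable_spectrum (bool * bool)%type.
Proof.
move=> s; rewrite ?card_prod card_bool.
have mk t u k : injective (klein_fun t) -> injective (klein_fun u) ->
    #|[pred w | w + klein_fun t w + klein_fun u w != 0]%R| = k -> liftable (bool * bool)%type k.
  move=> ti ui <-; exists (klein_fun t), (klein_fun u); split=> // w.
  by case: (_ + _)%R => [[] []].
case: s => [|[|[|[|[|//]]]]] // _ _.
- by apply: (mk [:: 0; 3; 1; 2] [:: 0; 2; 3; 1]); [do 2 case=> [[] []].. | rewrite card_klein].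
- by apply: (mk [:: 2; 1; 0; 3] [:: 2; 0; 1; 3]); [do 2 case=> [[] []].. | rewrite card_klein].
- by apply: (mk [:: 0; 3; 2; 1] [:: 0; 3; 2; 1]); [do 2 case=> [[] []].. | rewrite card_klein].
- by apply: (mk [:: 2; 3; 1; 0] [:: 1; 3; 2; 0]); [do 2 case=> [[] []].. | rewrite card_klein].
Qed.

Lemma liftable_cube : liftable_spectrum (bool * bool * bool)%type.
Proof.
move=> s; rewrite ?card_prod card_bool.
have mk t u k : injective (cube_fun t) -> injective (cube_fun u) ->
    #|[pred w | w + cube_fun t w + cube_fun u w != 0]%R| = k ->
    liftable (bool * bool * bool)%type k.
  move=> ti ui <-; exists (cube_fun t), (cube_fun u); split=> // w.
  by case: (_ + _)%R => [[[] []] []].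
(* The list of all eight elements turns injectivity into a boolean test that can be evaluated. *)
pose elts := [seq (x, b) | x <- [seq (x, y) | x <- [:: true; false], y <- [:: true; false]],
  b <- [:: true; false]].
have inj t : all (fun i => all (fun j => (cube_fun t i == cube_fun t j) ==> (i == j)) elts) elts ->
    injective (cube_fun t).
  move=> /allP H i j /eqP E; apply/eqP; move: (H i) => /(_ _)/allP H1.
  apply: (implyP (H1 _ j _)) E; by case: i {H1} => [[[] []] []]; case: j => [[[] []] []].
case: s => [|[|[|[|[|[|[|[|[|//]]]]]]]]] // _ _.
- apply: (mk [:: 1; 7; 0; 6; 4; 2; 5; 3] [:: 1; 6; 2; 5; 0; 7; 3; 4]);
    by [apply: inj | rewrite card_cube !card_klein].
- apply: (mk [:: 4; 3; 1; 7; 5; 2; 6; 0] [:: 4; 2; 3; 5; 1; 7; 0; 6]);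
    by [apply: inj | rewrite card_cube !card_klein].
- apply: (mk [:: 6; 2; 0; 5; 4; 3; 7; 1] [:: 6; 3; 2; 5; 0; 4; 1; 7]);
    by [apply: inj | rewrite card_cube !card_klein].
- apply: (mk [:: 1; 6; 4; 2; 0; 3; 5; 7] [:: 1; 7; 6; 3; 4; 5; 0; 2]);
    by [apply: inj | rewrite card_cube !card_klein].
- apply: (mk [:: 3; 4; 6; 5; 2; 0; 1; 7] [:: 3; 5; 4; 0; 1; 6; 2; 7]);
    by [apply: inj | rewrite card_cube !card_klein].
- apply: (mk [:: 6; 1; 3; 5; 2; 4; 0; 7] [:: 6; 0; 3; 4; 5; 2; 1; 7]);
    by [apply: inj | rewrite card_cube !card_klein].
- apply: (mk [:: 2; 6; 3; 4; 1; 0; 7; 5] [:: 2; 1; 3; 5; 4; 6; 7; 0]);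
    by [apply: inj | rewrite card_cube !card_klein].
- apply: (mk [:: 4; 0; 6; 1; 2; 7; 3; 5] [:: 2; 7; 0; 4; 1; 6; 3; 5]);
    by [apply: inj | rewrite card_cube !card_klein].
Qed.

(** Terms [w] are split off greedily. Only for [s = w + 1] would this leave the forbidden remainder
    1; then [w - 1] is split off and 2 remains, where [w > 2] keeps [w - 1] different from 1. *)
Lemma spectrum_sums (n w s : nat) :
  2 < w -> s <= n * w -> s != 1 ->
  exists2 t : seq nat, size t = n & sumn t = s /\ all (fun k => (k <= w) && (k != 1)) t.
Proof.
move=> w_gt2; elim: n s => [|n IHn] s; first by rewrite leqn0 => /eqP-> _; exists [::].
move=> le s1; case: (leqP s w) => [sw|ws].
  exists (s :: nseq n 0); first by rewrite /= size_nseq.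
  by rewrite /= sumn_nseq mul0n addn0 sw s1; split=> //; apply/allP=> k /nseqP[-> _].
case: (eqVneq s w.+1) => [Es|ns].
  case: n IHn le => [|n] IHn le; first by lia.
  have [t st [sum tP]] : exists2 t : seq nat, size t = n.+1 &
      sumn t = 2 /\ all (fun k => (k <= w) && (k != 1)) t by apply: IHn => //; nia.
  by exists (w.-1 :: t); rewrite /= ?st // sum tP; split; lia.
have [t st [sum tP]] : exists2 t : seq nat, size t = n &
    sumn t = s - w /\ all (fun k => (k <= w) && (k != 1)) t by apply: IHn; lia.
by exists (w :: t); rewrite /= ?st // sum tP; split; lia.
Qed.

Lemma spectrum_sums_fin (I : finType) (w s : nat) :
  2 < w -> s <= #|I| * w -> s != 1 ->
  exists t : I -> nat, \sum_i t i = s /\ forall i, t i <= w /\ t i != 1.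
Proof.
move=> w_gt2 le s1; have [t st [sum /allP tP]] := spectrum_sums w_gt2 le s1.
exists (fun i => nth 0 t (enum_rank i)); split=> [|i].
  rewrite -sum sumnE (big_nth 0) st big_mkord.
  by rewrite (reindex (@enum_rank I)) //=; apply/onW_bij/enum_rank_bij.
by apply/andP/tP/mem_nth; rewrite st.
Qed.

(** * Filling the groups of an inflated design *)

Lemma triangle_decomposition_card (T I : finType) (e : rel T) (f : I -> T -> T) x :
  triangle_decomposition e f -> #|I| * 2 = #|e x|.
Proof.
move=> [f3 sumf]; have : \sum_y \sum_i nadj (f i) x y = #|e x|.
  under eq_bigr do rewrite sumf.
  by rewrite -sum1_card [RHS]big_mkcond; apply: eq_bigr => y _; rewrite unfold_in; case: (e x y).
rewrite exchange_big (eq_bigr (fun=> 2)) => [|i _]; last exact: sum_nadj_nbr (f3 i).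
by rewrite sum_nat_const.
Qed.

Definition across_groups (U G : finType) : rel (U * G) := fun x y => x.1 != y.1.

(** The lifted factors cover the pairs in different groups. The decomposition on [G * W] is copied
    into all groups simultaneously, so each of its factors becomes a spanning factor; the 1-factor
    comes from these copies too. *)
Lemma hw_fill (U G : finType) (W : finZmodType) (I : finType) (f : I -> U * G -> U * G)
    (s : I -> nat) (s' : nat) :
  triangle_decomposition (@across_groups U G) f -> (forall i, liftable W (s i)) ->
  hw_decomposable (G * W)%type s' -> hw_decomposable (U * G * W)%type (\sum_i s i + s').
Proof.
move=> fP /(lift_triangle_decomposition fP)[J [hex [g [gP sumg _ <-]]]].
case=> F [K [hex' [k [FF kP sumk <-]]]].
pose h (u : G * W -> G * W) (x : U * G * W) : U * G * W :=
  let y := u (x.1.2, x.2) in (x.1.1, y.1, y.2).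
have hE u x y : (h u x == y) = (x.1.1 == y.1.1) && (u (x.1.2, x.2) == (y.1.2, y.2)).
  by case: x y => [[a b] c] [[a' b'] c']; rewrite /h /= !xpair_eqE andbA; case: (u _).
have hiter n u x : iter n (h u) x =
    (x.1.1, (iter n u (x.1.2, x.2)).1, (iter n u (x.1.2, x.2)).2).
  elim: n => [|n IHn] /=; first by case: x => [[]].
  by rewrite IHn /h /= -surjective_pairing.
have horb m u : orbits_of_size m u -> orbits_of_size m (h u).
  move=> um x; have [E H] := um (x.1.2, x.2); split=> [|j /H nE].
    by rewrite hiter E /= -!surjective_pairing.
  rewrite hiter; apply: contra nE; case: x {E H} => [[a b] c] /=.
  by rewrite [iter j u (b, c)]surjective_pairing /= => /eqP[-> ->].
exists (h F), (J + K)%type, (fun j => match j with inl j => hex j | inr j => hex' j end).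
exists (fun j => match j with inl j => g j | inr j => h (k j) end); split.
- exact: horb.
- by case=> [j|j]; [exact: gP | apply: horb].
- move=> x y; rewrite big_sumType /= sumg hE /across_groups.
  rewrite (eq_bigr (fun j => (x.1.1 == y.1.1) * nadj (k j) (x.1.2, x.2) (y.1.2, y.2))); last first.
    by move=> j _; rewrite /nadj !hE (eq_sym y.1.1); case: eqP => _ /=; rewrite ?mul1n.
  rewrite -big_distrr /= addnCA.
  have := sumk (x.1.2, x.2) (y.1.2, y.2).
  case: x y => [[a b] c] [[a' b'] c'] /=; rewrite !xpair_eqE.
  by case: (a == a') => //=; rewrite mul1n => ->.
- by rewrite -!sum1_card [LHS]big_mkcond big_sumType /= -!big_mkcond.
Qed.

Lemma hw_of_groups (U G : finType) (W : finZmodType) (I : finType) (f : I -> U * G -> U * G)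
    (s : nat) :
  triangle_decomposition (@across_groups U G) f -> liftable_spectrum W ->
  2 < #|W| -> #|G| * #|W| = 24 -> 2 < #|U| ->
  (forall k, k \in [:: 0; 1; 11] -> hw_decomposable 'I_24 k) ->
  s < 12 * #|U| -> hw_decomposable (U * G * W)%type s.
Proof.
move=> fP Wspec W_gt2 GW U_gt2 hw24 s_lt.
have cardI : #|I| * #|W| = 12 * (#|U| - 1).
  have UG : 0 < #|{: U * G}| by rewrite card_prod; nia.
  case/card_gt0P: UG => x _.
  have := triangle_decomposition_card x fP.
  rewrite (eq_card (B := setX [set~ x.1] [set: G])); last first.
    by move=> y; rewrite !inE andbT eq_sym.
  by rewrite cardsX cardsC1 cardsT => E; nia.
(* The groups contribute [s2] hexagon factors and the lift [s1]. The value [s = 1] is left to the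
   groups, and 11 is used once [s] exceeds the capacity [12 * (#|U| - 1)] of the lift. *)
suff [s1 [s2 [-> s2P s1P s1n]]] : exists s1 s2, [/\ s = s1 + s2, s2 \in [:: 0; 1; 11],
    s1 <= #|I| * #|W| & s1 != 1].
  have [t [<- tP]] := spectrum_sums_fin W_gt2 s1P s1n.
  apply: hw_fill fP _ _ => [i|]; first by have [? ?] := tP i; apply: Wspec.
  by apply: hw_decomposable_card (hw24 _ s2P); rewrite card_prod card_ord.
rewrite cardI; case: (eqVneq s 1) => [->|s1]; first by exists 0, 1.
case: (leqP s (12 * (#|U| - 1))) => le; first by exists s, 0; rewrite addn0.
by exists (s - 11), 11; split=> //; lia.
Qed.

(** * Resolvable designs and Kirkman frames *)

Lemma triangle_decomposition_bij (T T' I I' : finType) (h : T -> T') (h' : T' -> T)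
    (k : I' -> I) (k' : I -> I') (e : rel T) (f : I -> T -> T) :
  cancel h h' -> cancel h' h -> cancel k k' -> cancel k' k ->
  triangle_decomposition e f ->
  triangle_decomposition (fun x y => e (h' x) (h' y)) (fun i => conjf h h' (f (k i))).
Proof.
move=> hK h'K kK k'K [f3 sumf]; split=> [i|x y]; first exact: orbits_conjf.
under eq_bigr do rewrite nadj_conjf //.
by rewrite -sumf [RHS](reindex k) //=; exists k' => i _; [apply: kK | apply: k'K].
Qed.

(** A 3-RGDD of type [L^k], with the maps [f i] as its parallel classes. *)
Definition rgdd (k L : nat) : Prop :=
  exists (I : finType) (f : I -> 'I_k * 'I_L -> 'I_k * 'I_L),
    triangle_decomposition (@across_groups 'I_k 'I_L) f.

Notation rgdd6 k := (rgdd k 6).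

(** The [3 n] parallel classes are indexed by the groups other than [None] and by ['I_3]. This
    matches the indexing of the partial classes of a frame, which they complete in [fill_holes]. *)
Lemma rgdd6_index (n : nat) : rgdd6 n.+1 ->
  exists f : 'I_n * 'I_3 -> option 'I_n * 'I_6 -> option 'I_n * 'I_6,
    triangle_decomposition (@across_groups (option 'I_n) 'I_6) f.
Proof.
case=> I [f fP].
have cI : #|I| = #|{: 'I_n * 'I_3}|.
  have := triangle_decomposition_card (ord0, ord0) fP.
  rewrite (eq_card (B := setX [set~ ord0] [set: 'I_6])); last first.
    by move=> y; rewrite !inE andbT eq_sym.
  by rewrite cardsX cardsC1 cardsT card_prod !card_ord /= => E; lia.
have [k [k' [kK k'K]]] := eq_card_bij (esym cI).
have cn : #|'I_n.+1| = #|{: option 'I_n}| by rewrite card_option !card_ord.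
have [h [h' [hK h'K]]] := eq_card_bij cn.
pose H (x : 'I_n.+1 * 'I_6) := (h x.1, x.2).
pose H' (x : option 'I_n * 'I_6) := (h' x.1, x.2).
have HK : cancel H H' by case=> a b; rewrite /H /H' /= hK.
have H'K : cancel H' H by case=> a b; rewrite /H /H' /= h'K.
have [f3 sumf] := triangle_decomposition_bij HK H'K kK k'K fP.
exists (fun i => conjf H H' (f (k i))); split=> // x y.
by rewrite sumf /across_groups /= (inj_eq (can_inj h'K)).
Qed.

(* A Kirkman frame with groups [col @^-1 j * 'I_6]: a group of [6 m] points is missed by [3 m]
   partial classes, which are indexed here by its [m] points [w] and by ['I_3]. *)
Definition holey (W : finType) (J : eqType) (col : W -> J)
    (f : W -> 'I_3 -> W * 'I_6 -> W * 'I_6) : Prop :=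
  [/\ forall w i p, col p.1 = col w -> f w i p = p,
      forall w i p, col p.1 <> col w ->
        f w i (f w i (f w i p)) = p /\ col (f w i p).1 <> col p.1
    & forall p q, col p.1 <> col q.1 -> \sum_w \sum_i nadj (f w i) p q = 1].

Definition frame6 (n : nat) : Prop := exists f, @holey 'I_n _ id f.

(** An image inside the missed group would be fixed, so closing up after three steps would make [p]
    itself a fixed point. *)
Lemma holey_avoids (W : finType) (J : eqType) (col : W -> J) f w i p :
  holey col f -> col p.1 <> col w -> col (f w i p).1 <> col w.
Proof.
move=> [f0 f1 _] np E; have [E3 ne] := f1 w i p np.
by move: E3; rewrite !(f0 w i (f w i p)) // => Ep; apply: ne; rewrite Ep.
Qed.

(** A truncated line can keep no point or one point; no pair is then to be covered. *)
Lemma frame6_le1 (n : nat) : n <= 1 -> frame6 n.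
Proof.
move=> n1; exists (fun _ _ => id).
have E (a b : 'I_n) : a = b by apply: ord_inj; move: (ltn_ord a) (ltn_ord b); lia.
by split=> [//|w i p /(_ (E _ _))//|p q /(_ (E _ _))].
Qed.

(** The frame is transported by [enum_val]. The empty set is treated apart, since [enum_rank_in]
    requires a member. *)
Lemma frame6_on (W : finType) (S : {set W}) : frame6 #|S| ->
  exists f : W -> 'I_3 -> W * 'I_6 -> W * 'I_6,
  [/\ forall w i h, w \in S -> f w i (w, h) = (w, h),
      forall w i v h, w \in S -> v \in S -> v != w ->
        [/\ f w i (f w i (f w i (v, h))) = (v, h), (f w i (v, h)).1 \in S,
            (f w i (v, h)).1 != v & (f w i (v, h)).1 != w]
    & forall v h v' h', v \in S -> v' \in S -> v != v' ->
        \sum_(w in S) \sum_i nadj (f w i) (v, h) (v', h') = 1].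
Proof.
case=> f fP; have [f0 f1 f2] := fP.
have [S0|[x xS]] := set_0Vmem S.
  by exists (fun _ _ => id); split=> [w i h|w i v h|v h v' h']; rewrite S0 inE.
pose r := enum_rank_in xS.
have rK k : r (enum_val k) = k := enum_valK_in xS k.
have eK w : w \in S -> enum_val (r w) = w := enum_rankK_in xS (x := w).
pose up (q : 'I_#|S| * 'I_6) : W * 'I_6 := (enum_val q.1, q.2).
pose g w i (p : W * 'I_6) := up (f (r w) i (r p.1, p.2)).
have upK q : (r (up q).1, (up q).2) = q by rewrite /up /= rK -surjective_pairing.
have r_inj w v : w \in S -> v \in S -> r v = r w -> v = w.
  by move=> wS vS E; rewrite -(eK w) // -(eK v) // E.
exists g; split.
- by move=> w i h wS; rewrite /g /up f0 //= eK.
- move=> w i v h wS vS nvw; rewrite /g !upK.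
  have nr : id (r v) <> id (r w) by move=> /r_inj-/(_ wS vS) E; rewrite E eqxx in nvw.
  have [E ne] := f1 (r w) i (r v, h) nr; have av := holey_avoids (i := i) (p := (r v, h)) fP nr.
  split.
  + by rewrite E /up /= eK.
  + exact: enum_valP.
  + by apply/eqP => /(congr1 r); rewrite rK => /ne.
  + by apply/eqP => /(congr1 r); rewrite rK => /av.
- move=> v h v' h' vS v'S nvv'.
  transitivity (\sum_k \sum_i nadj (f k i) (r v, h) (r v', h')); last first.
    by apply: f2 => /= /r_inj-/(_ v'S vS) E; rewrite E eqxx in nvv'.
  rewrite big_enum_val /=; apply: eq_bigr => k _; apply: eq_bigr => i _.
  rewrite /nadj /g !rK.
  have eqE q a b : a \in S -> (up q == (a, b)) = (q == (r a, b)).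
    move=> aS; apply/eqP/eqP => [E|->]; last by rewrite /up /= eK.
    by rewrite -[q]upK E.
  by rewrite !eqE.
Qed.

(** The point set of a filled hole: the groups in [S] and the extra group [None], which all holes
    share. *)
Definition in_filled (W : finType) (S : {set W}) (p : option W * 'I_6) : bool :=
  if p.1 is Some v then v \in S else true.

Lemma rgdd6_on (W : finType) (S : {set W}) : rgdd6 #|S|.+1 ->
  exists f : W -> 'I_3 -> option W * 'I_6 -> option W * 'I_6,
  [/\ forall w i p, w \in S -> in_filled S p ->
        [/\ f w i (f w i (f w i p)) = p, f w i p != p & in_filled S (f w i p)]
    & forall p q, in_filled S p -> in_filled S q ->
        \sum_(w in S) \sum_i nadj (f w i) p q = (p.1 != q.1)].
Proof.
case/rgdd6_index=> f [f3 sumf].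
have [S0|[x xS]] := set_0Vmem S.
  exists (fun _ _ => id); split=> [w i p|]; first by rewrite S0 inE.
  have nS v : v \in S = false by rewrite S0 inE.
  by move=> [[v|] h] [[v'|] h']; rewrite /in_filled /= ?nS // big_pred0.
pose r := enum_rank_in xS.
have rK k : r (enum_val k) = k := enum_valK_in xS k.
have eK w : w \in S -> enum_val (r w) = w := enum_rankK_in xS (x := w).
pose up (q : option 'I_#|S| * 'I_6) : option W * 'I_6 := (omap enum_val q.1, q.2).
pose dn (q : option W * 'I_6) : option 'I_#|S| * 'I_6 := (omap r q.1, q.2).
have upK q : dn (up q) = q by case: q => [[a|] b]; rewrite /up /dn //= rK.
have dnK q : in_filled S q -> up (dn q) = q.
  by case: q => [[a|] b] //= aS; rewrite /up /dn /= eK.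
have upD q : in_filled S (up q).
  by case: q => [[a|] b] //; apply: enum_valP.
pose g w i p := up (f (r w, i) (dn p)).
exists g; split.
- move=> w i p wS pD; rewrite /g !upK.
  have [E H] := f3 (r w, i) (dn p); have {H} := H 1 isT; rewrite /= in E * => ne.
  split; [rewrite E; exact: dnK | | exact: upD].
  by apply: contra ne => /eqP {2}<-; rewrite upK.
- move=> p q pD qD.
  rewrite big_enum_val /= (eq_bigr (fun k => \sum_i nadj (f (k, i)) (dn p) (dn q))).
    rewrite (pair_bigA _ (fun k i => nadj (f (k, i)) (dn p) (dn q))) /=.
    rewrite (eq_bigr (fun k => nadj (f k) (dn p) (dn q))) => [|[]//].
    rewrite sumf /across_groups; congr nat_of_bool; congr negb.
    apply/eqP/eqP => [E|E]; last by rewrite /dn /= E.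
    have [Ep Eq] := (congr1 fst (dnK p pD), congr1 fst (dnK q qD)).
    exact: etrans (esym Ep) (etrans (congr1 (omap enum_val) E) Eq).
  move=> k _; apply: eq_bigr => i _; rewrite /nadj /g !rK.
  have eqE a b : in_filled S b -> (up a == b) = (a == dn b).
    by move=> bD; apply/eqP/eqP => [<-|->]; rewrite ?upK ?dnK.
  by rewrite !eqE.
Qed.

(** This is Wilson's construction. The blocks through [w] partition the remaining points of the
    other groups, so the partial classes at [w] of the frames on these blocks unite to partial
    classes missing the whole group of [w]. *)
Lemma glue_frames (W B : finType) (J : eqType) (col : W -> J) (inc : B -> {set W}) :
  (forall v v', col v != col v' -> exists b, v \in inc b /\ v' \in inc b) ->
  (forall b b' v v', v \in inc b -> v' \in inc b -> v \in inc b' -> v' \in inc b' ->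
     v != v' -> b = b') ->
  (forall b v v', v \in inc b -> v' \in inc b -> v != v' -> col v != col v') ->
  (forall b, frame6 #|inc b|) ->
  exists f, holey col f.
Proof.
move=> incE incU incC Fr.
have /fin_all_exists[F FP] := fun b => frame6_on (Fr b).
pose f w i (p : W * 'I_6) :=
  if [pick b | [&& w \in inc b, p.1 \in inc b & col p.1 != col w]] is Some b
  then F b w i p else p.
have fE b w i p : w \in inc b -> p.1 \in inc b -> col p.1 != col w -> f w i p = F b w i p.
  move=> wb pb npw; rewrite /f; case: pickP => [b' /and3P[wb' pb' _]|/(_ b)]; last first.
    by rewrite wb pb npw.
  rewrite (incU b b' w p.1) //; apply: contra npw => /eqP->; exact: eqxx.
have f0 w i p : col p.1 = col w -> f w i p = p.
  by move=> E; rewrite /f; case: pickP => // b; rewrite E eqxx !andbF.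
have f1 w i p b : w \in inc b -> p.1 \in inc b -> col p.1 != col w ->
    [/\ f w i (f w i (f w i p)) = p, (f w i p).1 \in inc b,
        col (f w i p).1 != col p.1 & col (f w i p).1 != col w].
  case: p => v h /= wb vb nvw; have [_ F1 _] := FP b.
  have step u k : u \in inc b -> u != w -> col u != col w /\ f w i (u, k) = F b w i (u, k).
    move=> ub nuw; have := incC _ _ _ ub wb nuw; split=> //; exact: fE.
  have [|n E] := step v h vb; first by apply: contra nvw => /eqP->.
  have nvw' : v != w by apply: contra nvw => /eqP->.
  have [F3 inb ne1 ne2] := F1 w i v h wb vb nvw'.
  rewrite E; split=> //; [|exact: incC inb vb ne1|exact: incC inb wb ne2].
  move: F3 inb ne2; case: (F b w i (v, h)) => v1 h1 /= F3 inb ne2.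
  have [_ E1] := step v1 h1 inb ne2; rewrite E1.
  have [_ inb2 _ ne3] := F1 w i v1 h1 wb inb ne2.
  move: F3 inb2 ne3; case: (F b w i (v1, h1)) => v2 h2 /= F3 inb2 ne3.
  by have [_ ->] := step v2 h2 inb2 ne3.
exists f; split=> //.
- move=> w i p /eqP npw; have [b [pb wb]] := incE _ _ npw.
  by have [E _ ne _] := f1 w i p b wb pb npw; split=> //; apply/eqP.
move=> [v h] [v' h'] /eqP /= nvv'; have [b [vb v'b]] := incE _ _ nvv'.
have nvv : v != v' by apply: contra nvv' => /eqP->.
have [F0 _ F2] := FP b.
rewrite (bigID (mem (inc b))) /= [X in _ + X]big1 ?addn0 => [|w nwb].
  apply: etrans (F2 v h v' h' vb v'b nvv); apply: eq_bigr => w wb; apply: eq_bigr => i _.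
  have fF u k : u \in inc b -> f w i (u, k) = F b w i (u, k).
    move=> ub; case: (eqVneq u w) => [->|nuw]; first by rewrite f0 // F0.
    by apply: fE => //; apply: incC ub wb nuw.
  by rewrite /nadj !fF.
rewrite big1 // => i _; apply/eqP; rewrite addn_eq0 !eqb0.
(* A block [b] avoiding [w] gains nothing from the classes at [w]: an arc between two of its points
   would lie in a block through [w], which shares two points with [b] and so equals it. *)
have no u k u' k' : u \in inc b -> u' \in inc b -> col u != col u' -> f w i (u, k) != (u', k').
  move=> ub u'b nuu'; apply/eqP => E; case: (eqVneq (col u) (col w)) => [Ec|nuw].
    by move: E nuu'; rewrite f0 // => -[-> _]; rewrite eqxx.
  have [b' [ub' wb']] := incE _ _ nuw.
  have [_ inb' _ _] := f1 w i (u, k) b' wb' ub' nuw.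
  move: inb'; rewrite E /= => u'b'; move: nwb; rewrite (incU b b' u u') ?wb' //.
  by apply: contra nuu' => /eqP->.
by rewrite !no // eq_sym.
Qed.

(** A hole of [m] points together with [None] carries a 3-RGDD of type [6^(m+1)]. Its [3 m] parallel
    classes complete the [3 m] partial classes that miss the hole. *)
Lemma fill_holes (W J : finType) (col : W -> J) f :
  holey col f -> (forall j, rgdd6 #|[set w | col w == j]|.+1) -> rgdd6 #|W|.+1.
Proof.
move=> fH R; have [f0 f1 f2] := fH.
have fav w i p (np : col p.1 <> col w) : col (f w i p).1 <> col w := holey_avoids fH np.
have /fin_all_exists[r rP] := fun j => rgdd6_on (R j).
pose g (k : W * 'I_3) (p : option W * 'I_6) : option W * 'I_6 :=
  if p.1 is Some v then
    if col v == col k.1 then r (col k.1) k.1 k.2 p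
    else let q := f k.1 k.2 (v, p.2) in (Some q.1, q.2)
  else r (col k.1) k.1 k.2 p.
have inS w : w \in [set w' | col w' == col w] by rewrite inE.
have gr w i p : in_filled [set w' | col w' == col w] p -> g (w, i) p = r (col w) w i p.
  by case: p => [[v|] h] //; rewrite /in_filled /= inE /g /= => ->.
have gf w i v h : col v != col w ->
    g (w, i) (Some v, h) = (Some (f w i (v, h)).1, (f w i (v, h)).2).
  by rewrite /g /= => /negPf->.
pose lft (q : W * 'I_6) : option W * 'I_6 := (Some q.1, q.2).
have gf' w i q : col q.1 <> col w -> g (w, i) (lft q) = lft (f w i q).
  by case: q => v h /eqP; apply: gf.
have lft_inj : injective lft by move=> [a b] [c d] [-> ->].
have gP : triangle_decomposition (@across_groups (option W) 'I_6) g.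
  split=> [[w i]|p q].
    have [r3 _] := rP (col w).
    have H p : g (w, i) (g (w, i) (g (w, i) p)) = p /\ g (w, i) p != p.
      case fp: (in_filled [set w' | col w' == col w] p).
        have [E3 E1 D1] := r3 w i p (inS w) fp; have [_ _ D2] := r3 w i _ (inS w) D1.
        by rewrite !gr.
      case: p fp => [[v|] h] //; rewrite /in_filled /= inE => /negbT/eqP nvw.
      have [E3 ne] := f1 w i (v, h) nvw; have n1 := fav w i (v, h) nvw.
      have n2 := fav w i _ n1; rewrite -[(Some v, h)]/(lft (v, h)) !gf' // E3; split=> //.
      by apply/eqP => /lft_inj E; apply: ne; rewrite E.
    by apply: orbits3P => p; case: (H p).
  rewrite -(pair_bigA _ (fun w i => nadj (g (w, i)) p q)) /=.
  have nC (h : option W * 'I_6 -> option W * 'I_6) a b : nadj h a b = nadj h b a.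
    by rewrite /nadj addnC.
  have gG w i a : in_filled [set w' | col w' == col w] a ->
      in_filled [set w' | col w' == col w] (g (w, i) a).
    by move=> aw; rewrite gr //; have [r3 _] := rP (col w); have [] := r3 w i a (inS w) aw.
  (* A class indexed by [w] maps the filled hole of [w] to itself and the other points among
     themselves, so no arc joins the two parts. *)
  have cross w a b : in_filled [set w' | col w' == col w] a -> col b.1 <> col w ->
      \sum_i nadj (g (w, i)) a (lft b) = 0.
    move=> aw nb; rewrite big1 // => i _; apply/eqP; rewrite addn_eq0 !eqb0 gf' //.
    apply/andP; split; apply/eqP => E.
      by have := gG w i a aw; rewrite E /in_filled /= inE => /eqP.
    by move: aw; rewrite -E /in_filled /= inE => /eqP/(fav w i b nb).
  have inner w : in_filled [set w' | col w' == col w] p -> in_filled [set w' | col w' == col w] q ->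
      \sum_i nadj (g (w, i)) p q = \sum_i nadj (r (col w) w i) p q.
    by move=> pw qw; apply: eq_bigr => i _; rewrite /nadj !gr.
  have outer w a b : col a.1 <> col w -> col b.1 <> col w ->
      \sum_i nadj (g (w, i)) (lft a) (lft b) = \sum_i nadj (f w i) a b.
    by move=> na nb; apply: eq_bigr => i _; rewrite /nadj !gf' // !(inj_eq lft_inj).
  (* Inside one filled hole only the classes indexed by its own points should count, and these form
     the whole design [r j]. *)
  have hole j : in_filled [set w | col w == j] p -> in_filled [set w | col w == j] q ->
      (forall w, col w <> j -> \sum_i nadj (g (w, i)) p q = 0) ->
      \sum_w \sum_i nadj (g (w, i)) p q = across_groups p q.
    move=> pj qj out; have [_ <- //] := rP j.
    rewrite (bigID (mem [set w | col w == j])) /= [X in _ + X]big1 ?addn0 => [|w]; last first.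
      by rewrite inE => /eqP/out.
    by apply: eq_bigr => w; rewrite inE => /eqP Ew; rewrite -Ew in pj qj *; exact: inner.
  case: p q nC inner hole => [[v|] h] [[v'|] h'] nC inner hole.
  - have lE a b : (Some a, b) = lft (a, b) by [].
    case: (eqVneq (col v) (col v')) => [E|/eqP nvv'].
      apply: (hole (col v)); rewrite /in_filled /= ?inE ?E // => w nw.
      rewrite !lE outer /= ?E; try by move=> H; apply: nw.
      rewrite big1 // => i _; apply/eqP; rewrite addn_eq0 !eqb0; apply/andP; split.
        by apply/eqP => H; have [|_] := f1 w i (v, h); rewrite /= ?E ?H //=; move=> H'; apply: nw.
      apply/eqP => H; have [|_] := f1 w i (v', h'); rewrite /= -?E ?H //=.
      by move=> H'; apply: nw; rewrite -E.
    have nv : v != v' by apply/eqP => Ev; apply: nvv'; rewrite Ev.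
    rewrite /across_groups /= (inj_eq Some_inj) nv -[nat_of_bool true](f2 (v, h) (v', h') nvv').
    (* For points of different holes the new classes and the frame agree for every [w]; both counts
       vanish when [w] shares its hole with one of the points. *)
    apply: eq_bigr => w _.
    have zero a b k l : col a = col w -> col b <> col w ->
        \sum_i nadj (f w i) (a, k) (b, l) = 0.
      move=> Ea nb; rewrite big1 // => i _; apply/eqP; rewrite addn_eq0 !eqb0 f0 //.
      apply/andP; split; apply/eqP => E; first by case: E Ea => -> _ /nb.
      by have := fav w i (b, l) nb; rewrite E.
    have infill a k : col a = col w -> in_filled [set w' | col w' == col w] (Some a, k).
      by rewrite /in_filled /= inE => ->.
    case: (eqVneq (col v) (col w)) => [E|/eqP nvw].
      have nv'w : col v' <> col w by rewrite -E => /esym.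
      by rewrite zero // [(Some v', h')]lE cross //; apply: infill.
    case: (eqVneq (col v') (col w)) => [E|/eqP nv'w]; last by rewrite !lE outer.
    have -> : \sum_i nadj (f w i) (v, h) (v', h') = \sum_i nadj (f w i) (v', h') (v, h).
      by apply: eq_bigr => i _; rewrite /nadj addnC.
    rewrite zero //; under eq_bigr do rewrite nC.
    by rewrite [(Some v, h)]lE cross //; apply: infill.
  - apply: (hole (col v)); rewrite /in_filled /= ?inE // => w nw.
    under eq_bigr do rewrite nC.
    by rewrite -[(Some v, h)]/(lft (v, h)) cross //= => /esym.
  - apply: (hole (col v')); rewrite /in_filled /= ?inE // => w nw.
    by rewrite -[(Some v', h')]/(lft (v', h')) cross //= => /esym.
  - apply: etrans (_ : 0 = _) => //; rewrite big1 // => w _; rewrite inner //.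
    have [_ r2] := rP (col w); have := r2 (None, h) (None, h') isT isT.
    by move/eqP; rewrite eqxx sum_nat_eq0 => /forall_inP/(_ w (inS w))/eqP.
have cn : #|{: option W}| = #|'I_#|W|.+1| by rewrite card_option card_ord.
have [h [h' [hK h'K]]] := eq_card_bij cn.
pose H (x : option W * 'I_6) := (h x.1, x.2).
pose H' (x : 'I_#|W|.+1 * 'I_6) := (h' x.1, x.2).
have HK : cancel H H' by case=> a b; rewrite /H /H' /= hK.
have H'K : cancel H' H by case=> a b; rewrite /H /H' /= h'K.
have idK : cancel (@id (W * 'I_3)) id by [].
have [g3 sumg] := triangle_decomposition_bij HK H'K idK idK gP.
exists (W * 'I_3)%type, (fun i => conjf H H' (g i)); split=> // x y.
by rewrite sumg /across_groups /= (inj_eq (can_inj h'K)).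
Qed.

(** * Truncated transversal designs *)

(** Blocks of a transversal design over [Z_n]: group 0 records the slope [s], and group [j > 0] the
    value at [j - 1] of the affine function with slope [s] and constant term [a]. *)
Definition line (n a s j : nat) : nat := if j == 0 then s else (a + j.-1 * s) %% n.

Lemma line_lt n a s j : s < n -> line n a s j < n.
Proof. by move=> sn; rewrite /line; case: eqP => // _; rewrite ltn_mod (leq_ltn_trans _ sn). Qed.

Lemma modn_coprime_inj n d s t :
  coprime n d -> s < n -> t < n -> d * s = d * t %[mod n] -> s = t.
Proof.
move=> co; wlog le : s t / s <= t => [W sn tn E|sn tn /esym/eqP].
  by case/orP: (leq_total s t) => le; [apply: W | apply/esym/W].
rewrite eqn_mod_dvd ?leq_mul // -mulnBr Gauss_dvdr // => dv.
apply/eqP; rewrite eqn_leq le -subn_eq0 -leqn0 leqNgt; apply/negP => /dvdn_leq/(_ dv).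
by lia.
Qed.

(** Subtracting the two agreements in groups [j < j'], both nonzero, gives equal multiples of the
    slopes by [j' - j], which is at most [g - 2] and so invertible modulo [n]. If [j = 0], the
    slopes agree at once. *)
Lemma line_unique n g a s b t j j' :
  (forall d, 0 < d < g.-1 -> coprime n d) -> a < n -> s < n -> b < n -> t < n ->
  j < g -> j' < g -> j != j' ->
  line n a s j = line n b t j -> line n a s j' = line n b t j' -> (a, s) = (b, t).
Proof.
move=> co an sn bn tn.
have slope : s = t -> forall k, k != 0 -> line n a s k = line n b t k -> (a, s) = (b, t).
  move=> <- k /negPf nk; rewrite /line nk => /eqP.
  by rewrite eqn_modDr !modn_small // => /eqP->.
wlog lt : j j' / j < j' => [W jg j'g njj' Ej Ej'|].
  have: (j < j') || (j' < j) by rewrite -neq_ltn.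
  by case/orP=> lt; [apply: (W j j') | apply: (W j' j); rewrite // eq_sym].
move=> jg j'g njj'; case: (posnP j) => [->|j_gt0] Ej Ej'.
  by apply: (slope _ j') => //; lia.
apply: (slope _ j) => //; last by lia.
have [nj nj'] : (j == 0) = false /\ (j' == 0) = false by lia.
move: Ej Ej'; rewrite /line nj nj'.
have -> : j'.-1 = j.-1 + (j' - j) by lia.
move=> Ej; rewrite !mulnDl !addnA -(modnDml (b + _)) -Ej modnDml => /eqP.
rewrite eqn_modDl => /eqP; apply: modn_coprime_inj => //.
by apply: co; lia.
Qed.

(** The [n^2] lines give distinct pairs of points in the groups [j] and [j'], so all [n^2] pairs
    occur. *)
Lemma line_through n g j j' x x' :
  (forall d, 0 < d < g.-1 -> coprime n d) -> x < n -> x' < n -> j < g -> j' < g -> j != j' ->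
  exists a s : 'I_n, line n a s j = x /\ line n a s j' = x'.
Proof.
move=> co xn x'n jg j'g nj.
pose f (p : 'I_n * 'I_n) : 'I_n * 'I_n :=
  (Ordinal (line_lt p.1 j (ltn_ord p.2)), Ordinal (line_lt p.1 j' (ltn_ord p.2))).
have f_inj : injective f.
  move=> [a s] [b t] [Ej Ej'].
  have [] := line_unique co (ltn_ord a) (ltn_ord s) (ltn_ord b) (ltn_ord t) jg j'g nj Ej Ej'.
  by move=> /ord_inj-> /ord_inj->.
have /codomP[[a s] [Ex Ex']] := inj_card_onto f_inj (leqnn _) (Ordinal xn, Ordinal x'n).
by exists a, s; rewrite -Ex -Ex'.
Qed.

Lemma card_ord_count n (P : pred nat) : #|[set x : 'I_n | P x]| = count P (iota 0 n).
Proof.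
rewrite -sum1_count -[n in iota _ n]subn0 -/(index_iota 0 n) big_mkord -sum1_card.
by apply: eq_bigl => x; rewrite inE.
Qed.

Lemma card_ord_geq n m : m <= n -> #|[set x : 'I_n | n - m <= x]| = m.
Proof.
move=> mn; rewrite (card_ord_count n (leq (n - m))) -[in iota _ _](subnK mn) iotaD count_cat.
rewrite (eq_in_count (a2 := pred0)) ?count_pred0 => [|x]; last first.
  by rewrite mem_iota /=; lia.
rewrite (eq_in_count (a2 := predT)) ?count_predT ?size_iota // => x.
by rewrite mem_iota /=; lia.
Qed.

(** Group [j] keeps its last [t j] points. The shortened lines are blocks for [glue_frames], and the
    groups become the holes for [fill_holes]. *)
Lemma truncated_TD (n g : nat) (t : nat -> nat) :
  (forall d, 0 < d < g.-1 -> coprime n d) ->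
  (forall j, j < g -> t j <= n) ->
  (forall a s, a < n -> s < n ->
     frame6 (count (fun j => n - t j <= line n a s j) (iota 0 g))) ->
  (forall j, j < g -> rgdd6 (t j).+1) ->
  rgdd6 (\sum_(j < g) t j).+1.
Proof.
move=> co tn Fr R.
pose keep (p : 'I_g * 'I_n) := n - t p.1 <= p.2.
pose W : finType := {p : 'I_g * 'I_n | keep p}.
pose col (w : W) := (val w).1.
pose inc (b : 'I_n * 'I_n) : {set W} := 
  [set w : W | nat_of_ord (val w).2 == line n b.1 b.2 (val w).1].
have W_eq (v v' : W) : (val v).1 = (val v').1 -> (val v).2 = (val v').2 -> v = v'.
  by move=> E1 E2; apply: val_inj; rewrite [val v]surjective_pairing E1 E2 -surjective_pairing.
have incC b (v v' : W) : v \in inc b -> v' \in inc b -> v != v' -> col v != col v'.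
  rewrite !inE => /eqP vb /eqP v'b; apply: contra => /eqP E; apply/eqP/W_eq => //.
  by apply: ord_inj; rewrite vb v'b -/(col v) E.
have [f fP] : exists f, holey col f.
  apply: (glue_frames (inc := inc)) => //.
  - move=> v v' nv.
    have [a [s [E E']]] := line_through co (ltn_ord (val v).2) (ltn_ord (val v').2)
      (ltn_ord (val v).1) (ltn_ord (val v').1) nv.
    by exists (a, s); rewrite !inE /= E E' !eqxx.
  - move=> [a s] [b r] v v' vb v'b vb' v'b' /(incC _ _ _ vb v'b) nv.
    move: vb v'b vb' v'b'; rewrite !inE => /eqP E1 /eqP E2 /eqP E3 /eqP E4.
    have [] := line_unique co (ltn_ord a) (ltn_ord s) (ltn_ord b) (ltn_ord r)
      (ltn_ord (val v).1) (ltn_ord (val v').1) nv (etrans (esym E1) E3) (etrans (esym E2) E4).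
    by move=> /ord_inj-> /ord_inj->.
  - move=> [a s]; have := Fr a s (ltn_ord a) (ltn_ord s); congr frame6.
    rewrite -(card_ord_count g (fun j => n - t j <= line n a s j)).
    (* A line meets each group once, so its surviving points are counted by groups. *)
    have col_inj : {in inc (a, s) &, injective col}.
      by move=> v v' vb v'b E; apply/eqP; apply: contraLR (incC _ _ _ vb v'b) _; rewrite E eqxx.
    rewrite -(card_in_imset col_inj); apply: eq_card => j; rewrite inE.
    apply/idP/imsetP => [le|[[[j' x] kx]]].
      pose x := Ordinal (line_lt a j (ltn_ord s)).
      have kx : keep (j, x) by [].
      by exists (exist _ (j, x) kx); rewrite // inE /=.
    by rewrite inE /col /= => /eqP E ->; rewrite -E.
have -> : \sum_(j < g) t j = #|W|.
  rewrite card_sig -sum1_card [RHS]big_mkcond /=.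
  rewrite (eq_bigr (fun p : 'I_g * 'I_n => if n - t p.1 <= p.2 then 1 else 0)) //.
  rewrite -(pair_bigA _ (fun (j : 'I_g) (x : 'I_n) => if n - t j <= x then 1 else 0)) /=.
  apply: eq_bigr => j _; rewrite -[LHS](card_ord_geq (tn j (ltn_ord j))) -sum1_card [LHS]big_mkcond.
  by apply: eq_bigr => x _; rewrite inE.
apply: (fill_holes fP) => j.
rewrite (_ : #|_| = t j); first exact: R.
have v2_inj : {in [set w | col w == j] &, injective (fun w : W => (val w).2)}.
  by move=> v v'; rewrite !inE => /eqP E /eqP E' E2; apply: W_eq => //; rewrite -/(col v) E.
rewrite -(card_in_imset v2_inj) -[RHS](card_ord_geq (tn j (ltn_ord j))).
apply: eq_card => x; rewrite inE; apply/imsetP/idP => [[[[j' x'] kx]]|le].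
  by rewrite inE /col /= => /eqP Ej ->; rewrite -Ej.
have kx : keep (j, x) by [].
by exists (exist _ (j, x) kx); rewrite // inE /=.
Qed.

(** * Checking explicit designs *)

(* A partial parallel class of triangles is the flat list of its triples. *)
Fixpoint next3 (s : seq nat) (p : nat) : nat :=
  if s is [:: a, b, c & s'] then
    if p == a then b else if p == b then c else if p == c then a else next3 s' p
  else p.

Fixpoint arcs3 (s : seq nat) : seq (nat * nat) :=
  if s is [:: a, b, c & s'] then [:: (a, b), (b, c), (c, a) & arcs3 s'] else [::].

Lemma triples_ind (P : seq nat -> Prop) :
  P [::] -> (forall a b c s, 3 %| size s -> P s -> P [:: a, b, c & s]) ->
  forall s, 3 %| size s -> P s.
Proof.
move=> P0 PS s; have [n] := ubnP (size s); elim: n s => // n IHn [|a [|b [|c s]]] //= lt dv.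
have dv' : 3 %| size s by rewrite -(dvdn_addr (size s) (dvdnn 3)).
by apply: PS => //; apply: IHn => //; lia.
Qed.

Lemma next3_notin s p : 3 %| size s -> p \notin s -> next3 s p = p.
Proof.
move=> dv; elim/triples_ind: s / dv => // a b c s _ IHs.
by rewrite !inE !negb_or /= => /and4P[/negPf-> /negPf-> /negPf-> /IHs].
Qed.

Lemma next3P s p : 3 %| size s -> uniq s -> p \in s ->
  [/\ next3 s (next3 s (next3 s p)) = p, next3 s p != p & next3 s p \in s].
Proof.
move=> dv; elim/triples_ind: s / dv p => // a b c s _ IHs p.
rewrite /= !inE !negb_or => /and4P[/and3P[ab ac as_] /andP[bc bs] cs us].
have [ba ca cb] : [/\ b == a = false, c == a = false & c == b = false].
  by rewrite (eq_sym b) (eq_sym c) (eq_sym c) (negPf ab) (negPf ac) (negPf bc).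
have simp := (negPf ab, negPf ac, negPf bc, ba, ca, cb, eqxx, orbT).
case: (eqVneq p a) => [->|pa]; first by do 4 rewrite ?simp /=.
case: (eqVneq p b) => [->|pb]; first by do 4 rewrite ?simp /=.
case: (eqVneq p c) => [->|pc]; first by do 4 rewrite ?simp /=.
move=> /= ps; have [E ne ins] := IHs p us ps.
have out q : q \in s -> [/\ q == a = false, q == b = false & q == c = false].
  by move=> qs; split; apply/negP => /eqP Eq; move: as_ bs cs; rewrite -?Eq qs.
have [-> -> ->] := out _ ins.
have [_ _ ins2] := IHs _ us ins; have [-> -> ->] := out _ ins2.
by rewrite E ins !orbT.
Qed.

Lemma count_arcs3 s p q : 3 %| size s -> uniq s ->
  count_mem (p, q) (arcs3 s) = (p \in s) && (next3 s p == q).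
Proof.
move=> dv; elim/triples_ind: s / dv => // a b c s _ IHs.
rewrite /= !inE !negb_or !xpair_eqE => /and4P[/and3P[ab ac as_] /andP[bc bs] cs us].
rewrite {}IHs // (eq_sym a) (eq_sym b p) (eq_sym c p) (eq_sym a q).
case: (eqVneq p a) => [->|pa] /=; first by rewrite (negPf ab) (negPf ac) (negPf as_) !addn0.
case: (eqVneq p b) => [->|pb] /=; first by rewrite (negPf bc) (negPf bs) !addn0.
by case: (eqVneq p c) => [->|pc] //=; rewrite (negPf cs) !addn0 eq_sym.
Qed.

Definition arcs (cls : seq (seq nat)) : seq (nat * nat) :=
  flatten [seq arcs3 s | s <- cls].

(** The pairs appear in lexicographic order, hence already sorted for the comparison in
    [covers_once]. *)
Definition cross_pairs (k L : nat) : seq (nat * nat) :=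
  [seq (p, q) | p <- iota 0 (k * L), q <- [seq q <- iota 0 (k * L) | p %/ L != q %/ L]].

(* Sorting binary codes keeps the comparison of the two edge lists cheap to evaluate. *)
Definition bin_pair (x : nat * nat) : N * N := (N.of_nat x.1, N.of_nat x.2).

Definition bin_leq (x y : N * N) : bool :=
  if N.eqb x.1 y.1 then N.leb x.2 y.2 else N.leb x.1 y.1.

Definition covers_once (k L : nat) (cls : seq (seq nat)) : bool :=
  sort bin_leq [seq bin_pair x | x <- arcs cls ++ [seq (x.2, x.1) | x <- arcs cls]]
    == [seq bin_pair x | x <- cross_pairs k L].

Lemma count_cross_pairs k L p q : p < k * L -> q < k * L ->
  count_mem (p, q) (cross_pairs k L) = (p %/ L != q %/ L).
Proof.
move=> pv qv; rewrite count_uniq_mem; last first.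
  apply: allpairs_uniq_dep => [|x _|]; rewrite ?filter_uniq ?iota_uniq //.
  by move=> [x y] [x' y'] _ _ [-> ->].
congr nat_of_bool; apply/allpairsPdep/idP => [[x [y [_ yin [-> ->]]]]|ne].
  by move: yin; rewrite mem_filter => /andP[].
by exists p, q; rewrite mem_filter ne !mem_iota; split.
Qed.

(** Sorting only permutes, so each ordered pair has the same multiplicity among the arcs, taken in
    both directions, as in [cross_pairs]. *)
Lemma covers_onceP k L cls : covers_once k L cls ->
  (forall s, s \in cls -> 3 %| size s /\ uniq s) ->
  (forall p q, p < k * L -> q < k * L ->
    \sum_(s <- cls) ((p \in s) && (next3 s p == q) + (q \in s) && (next3 s q == p))
      = (p %/ L != q %/ L)).
Proof.
move=> /eqP cov clsP p q pv qv; rewrite -(count_cross_pairs pv qv).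
have bin_inj : injective bin_pair.
  by move=> [a b] [c d] [/Nnat.Nat2N.inj-> /Nnat.Nat2N.inj->].
have cE (s : seq (nat * nat)) x : count_mem x s = count_mem (bin_pair x) [seq bin_pair y | y <- s].
  by rewrite count_map; apply: eq_count => y /=; rewrite (inj_eq bin_inj).
rewrite [RHS]cE -cov (permP (permEl (perm_sort _ _))) -cE count_cat count_map.
rewrite /arcs !count_flatten -!map_comp !sumnE !big_map -big_split /=.
apply: eq_big_seq => s /clsP[dv us]; rewrite count_arcs3 //; congr (_ + _).
rewrite -count_arcs3 //; apply: eq_count => -[a b] /=.
by rewrite !xpair_eqE andbC.
Qed.

Section Codes.

Variables k L : nat.

Definition code (x : 'I_k.+1 * 'I_L.+1) : nat := x.1 * L.+1 + x.2.

Definition decode (p : nat) : 'I_k.+1 * 'I_L.+1 := (inord (p %/ L.+1), inord (p %% L.+1)).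

Lemma code_div x : code x %/ L.+1 = x.1.
Proof. by rewrite divnMDl // divn_small ?ltn_ord // addn0. Qed.

Lemma code_lt x : code x < k.+1 * L.+1.
Proof. by rewrite -ltn_divLR // code_div. Qed.

Lemma codeK : cancel code decode.
Proof.
move=> x; rewrite /decode code_div /code modnMDl modn_small ?ltn_ord //.
by rewrite !inord_val -surjective_pairing.
Qed.

Lemma decodeK p : p < k.+1 * L.+1 -> code (decode p) = p.
Proof.
move=> pv; rewrite /code /decode /= !inordK ?ltn_mod ?ltn_divLR //.
by rewrite -divn_eq.
Qed.

Definition class_map (s : seq nat) (x : 'I_k.+1 * 'I_L.+1) := decode (next3 s (code x)).

End Codes.

Definition check_rgdd (k L : nat) (cls : seq (seq nat)) : bool :=
  [&& 3 %| k * L, all (fun s => sort leq s == iota 0 (k * L)) cls & covers_once k L cls].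

Lemma check_rgddP k L cls : check_rgdd k.+1 L.+1 cls -> rgdd k.+1 L.+1.
Proof.
case/and3P=> dv /allP clsP cov.
have clsE s : s \in cls -> perm_eq s (iota 0 (k.+1 * L.+1)).
  by move=> /clsP/eqP <-; rewrite perm_sym (permPl (permEl (perm_sort _ _))).
have cls3 s : s \in cls -> 3 %| size s /\ uniq s.
  by move/clsE=> ps; rewrite (perm_size ps) size_iota (perm_uniq ps) iota_uniq.
have clsm s p : s \in cls -> (p \in s) = (p < k.+1 * L.+1).
  by move/clsE/perm_mem=> ->; rewrite mem_iota.
have cE s (x y : 'I_k.+1 * 'I_L.+1) : s \in cls ->
    (class_map s x == y) = (next3 s (code x) == code y).
  move=> sc; have [dvs us] := cls3 s sc; have xs : code x \in s by rewrite clsm ?code_lt.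
  have [_ _ ys] := next3P dvs us xs; rewrite clsm // in ys.
  by rewrite -(inj_eq (can_inj (@codeK k L))) decodeK.
exists 'I_(size cls), (fun i : 'I_(size cls) => class_map (nth [::] cls i)); split.
  move=> i; have sc : nth [::] cls i \in cls by rewrite mem_nth.
  have [dvs us] := cls3 _ sc.
  apply: orbits3P => x; have xs : code x \in nth [::] cls i by rewrite clsm ?code_lt.
    have [E _ y1] := next3P dvs us xs; have [_ _ y2] := next3P dvs us y1.
    by rewrite /class_map !decodeK ?E ?codeK // -(clsm _ _ sc).
  by rewrite cE //; have [] := next3P dvs us xs.
move=> x y; have := covers_onceP cov cls3 (code_lt x) (code_lt y).
rewrite !code_div /across_groups => <-; rewrite (big_nth [::]) big_mkord.
apply: eq_bigr => i _; have sc : nth [::] cls i \in cls by rewrite mem_nth.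
by rewrite /nadj !cE // !clsm // !code_lt.
Qed.

Definition check_frame (k : nat) (fcls : seq (seq (seq nat))) : bool :=
  [&& size fcls == k,
      all (fun w => (size (nth [::] fcls w) == 3) &&
             all (fun s => (3 %| size s) && (sort leq s == [seq p <- iota 0 (k * 6) | p %/ 6 != w]))
               (nth [::] fcls w)) (iota 0 k)
    & covers_once k 6 (flatten fcls)].

Lemma check_frameP k fcls : check_frame k.+1 fcls -> frame6 k.+1.
Proof.
case/and3P=> /eqP szf /allP clsP cov.
have clsE w s : w < k.+1 -> s \in nth [::] fcls w ->
    3 %| size s /\ perm_eq s [seq p <- iota 0 (k.+1 * 6) | p %/ 6 != w].
  move=> wk; have /clsP/andP[_ /allP H] : w \in iota 0 k.+1 by rewrite mem_iota.
  by move=> /H/andP[dv /eqP <-]; rewrite perm_sym (permPl (permEl (perm_sort _ _))).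
have sz3 w : w < k.+1 -> size (nth [::] fcls w) = 3.
  move=> wk; have /clsP/andP[/eqP //] : w \in iota 0 k.+1 by rewrite mem_iota.
have cls3 s : s \in flatten fcls -> 3 %| size s /\ uniq s.
  case/flattenP=> c /(nthP [::])[w wk <-] sw; rewrite szf in wk.
  have [dv ps] := clsE w s wk sw; split=> //.
  by rewrite (perm_uniq ps) filter_uniq ?iota_uniq.
have clsm w s p : w < k.+1 -> s \in nth [::] fcls w -> p < k.+1 * 6 -> (p \in s) = (p %/ 6 != w).
  move=> wk sw pv; have [_ /perm_mem->] := clsE w s wk sw.
  by rewrite mem_filter mem_iota leq0n add0n pv !andbT.
have in_cls w s : w < k.+1 -> s \in nth [::] fcls w -> s \in flatten fcls.
  by move=> wk sw; apply/flattenP; exists (nth [::] fcls w); rewrite ?mem_nth ?szf.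
pose cl (w : 'I_k.+1) (i : 'I_3) := nth [::] (nth [::] fcls w) i.
have clw w i : cl w i \in nth [::] fcls w by rewrite mem_nth ?sz3 ?ltn_ord.
have clm w i (x : 'I_k.+1 * 'I_6) : (code x \in cl w i) = (x.1 != w).
  by rewrite (clsm w) ?code_div ?code_lt ?ltn_ord.
have cl3 w i := cls3 _ (in_cls _ _ (ltn_ord w) (clw w i)).
have cllt w i p : p \in cl w i -> p < k.+1 * 6.
  have [_ /perm_mem->] := clsE w _ (ltn_ord w) (clw w i).
  by rewrite mem_filter mem_iota => /andP[].
have nextE w i (x : 'I_k.+1 * 'I_6) : x.1 != w ->
    code (class_map (cl w i) x) = next3 (cl w i) (code x).
  rewrite -(clm w i) => xs; have [dv us] := cl3 w i.
  by rewrite decodeK //; have [_ _ /cllt] := next3P dv us xs.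
have sumE (x y : 'I_k.+1 * 'I_6) :
  \sum_w \sum_i ((x.1 != w) && (next3 (cl w i) (code x) == code y) +
    (y.1 != w) && (next3 (cl w i) (code y) == code x)) = (x.1 != y.1).
  have := covers_onceP cov cls3 (code_lt x) (code_lt y); rewrite !code_div => <-.
  rewrite big_flatten /= (big_nth [::]) szf big_mkord; apply: eq_bigr => w _.
  rewrite (big_nth [::]) sz3 ?ltn_ord // big_mkord; apply: eq_bigr => i _.
  by rewrite -/(cl w i) !clm.
(* The arc from [x] to its image is counted at least once, and the covering condition allows this
   only between different groups. *)
have ch w i (x : 'I_k.+1 * 'I_6) : x.1 != w -> (class_map (cl w i) x).1 != x.1.
  move=> xw; rewrite eq_sym; have := sumE x (class_map (cl w i) x).
  rewrite (bigD1 w) //= (bigD1 i) //= nextE // xw eqxx.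
  by case: (x.1 != _).
exists (fun w i => class_map (cl w i)); split.
- move=> w i x /= /eqP; rewrite -[_ == _]negbK -(clm w i) => xs.
  by rewrite /class_map next3_notin ?codeK //; case: (cl3 w i).
- move=> w i x /= /eqP xw; have xs : code x \in cl w i by rewrite clm.
  have [dv us] := cl3 w i; have [E _ y1] := next3P dv us xs; have [_ _ y2] := next3P dv us y1.
  split; last by apply/eqP/ch.
  by rewrite /class_map !decodeK ?E ?codeK //; apply: (cllt w i).
- move=> x y /= /eqP nxy; apply: etrans (_ : nat_of_bool (x.1 != y.1) = 1); last by rewrite nxy.
  rewrite -sumE; apply: eq_bigr => w _; apply: eq_bigr => i _.
  have half (a b : 'I_k.+1 * 'I_6) : a.1 != b.1 ->
      (class_map (cl w i) a == b : nat) = (a.1 != w) && (next3 (cl w i) (code a) == code b).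
    move=> nab; case aw: (a.1 != w) => /=.
      by rewrite -nextE // (inj_eq (can_inj (@codeK _ _))).
    move: aw; rewrite -(clm w i) => /negbT aw.
    rewrite /class_map next3_notin ?codeK //; last by case: (cl3 w i).
    by case: (a =P b) nab => // ->; rewrite eqxx.
  by rewrite /nadj !half // eq_sym.
Qed.

(** * Explicit designs *)

(* Point [h] of group [x] is coded by [x * L + h]: [turn] rotates the first [n] groups and fixes
   the others, [relabel] rotates the points inside every group. *)
Definition turn (n L u p : nat) : nat :=
  if p < n * L then (p + u * L) %% (n * L) else p.

Definition relabel (L s p : nat) : nat := p %/ L * L + (p %% L + s) %% L.

Definition image_class (n L u s : nat) (B : seq nat) : seq nat :=
  [seq turn n L u (relabel L s p) | p <- B].

Definition orbit_class (n L : nat) (S B : seq nat) : seq nat :=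
  flatten [seq image_class n L u s B | s <- S, u <- iota 0 n].

(* The base classes and blocks below were found by simulated annealing.
   Base classes contribute all their images; every short block is the orbit representative of a
   class that is invariant under the group. *)
Definition develop (n L : nat) (S : seq nat) (base short : seq (seq nat)) : seq (seq nat) :=
  flatten [seq [seq image_class n L u s B | s <- S, u <- iota 0 n] | B <- base]
    ++ [seq orbit_class n L S t | t <- short].

(** The base class [B] misses group 0; rotation by [w] moves the gap to group [w], and the three
    relabellings give the three classes missing it. *)
Definition develop_frame (n : nat) (B : seq nat) : seq (seq (seq nat)) :=
  [seq [seq image_class n 6 w s B | s <- [:: 0; 2; 4]] | w <- iota 0 n].

(** Type [6^k] has [3 (k - 1)] classes. For even [k] one group is fixed and [k - 1] are rotated,
    with three relabellings of one base class, or three base classes if [k = 4]. For odd [k] all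
    groups rotate: there are [2 k] images of the base class and [k - 3] short classes. *)
Lemma rgdd6_4 : rgdd 4 6.
Proof.
apply: (@check_rgddP 3 5 (develop 3 6 [:: 0] [:: [:: 2; 10; 18; 17; 7; 1; 8; 15; 23; 21; 9; 14;
    19; 5; 12; 16; 0; 6; 20; 11; 3; 13; 22; 4]; [:: 9; 15; 0; 16; 19; 2; 17; 3; 22; 7; 20; 4;
    11; 18; 12; 5; 21; 10; 13; 23; 6; 1; 14; 8]; [:: 17; 5; 8; 7; 18; 15; 2; 12; 20; 0; 14; 22;
    23; 4; 11; 1; 21; 6; 16; 3; 10; 19; 9; 13]] [::]));
by vm_compute.
Qed.

Lemma rgdd6_5 : rgdd 5 6.
Proof.
apply: (@check_rgddP 4 5 (develop 5 6 [:: 0; 3] [:: [:: 1; 18; 13; 6; 17; 24; 23; 29; 14; 8; 20;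
    0; 10; 3; 25; 7; 16; 2; 11; 28; 22; 19; 9; 5; 21; 27; 12; 15; 4; 26]] [:: [:: 0; 29; 22];
    [:: 0; 14; 10]]));
by vm_compute.
Qed.

Lemma rgdd6_6 : rgdd 6 6.
Proof.
apply: (@check_rgddP 5 5 (develop 5 6 [:: 0; 2; 4] [:: [:: 14; 1; 33; 27; 0; 11; 32; 15; 20; 21;
    10; 28; 18; 35; 26; 8; 22; 29; 16; 25; 19; 3; 13; 31; 17; 9; 5; 30; 4; 23; 7; 34; 24; 6; 12;
    2]] [::]));
by vm_compute.
Qed.

Lemma rgdd6_8 : rgdd 8 6.
Proof.
apply: (@check_rgddP 7 5 (develop 7 6 [:: 0; 2; 4] [:: [:: 11; 41; 2; 23; 8; 25; 29; 46; 4; 32;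
    20; 0; 15; 10; 26; 43; 12; 39; 18; 36; 31; 44; 1; 28; 33; 14; 47; 19; 34; 38; 9; 40; 45; 30;
    24; 22; 5; 13; 6; 27; 21; 37; 17; 7; 35; 3; 42; 16]] [::]));
by vm_compute.
Qed.

Lemma rgdd6_9 : rgdd 9 6.
Proof.
apply: (@check_rgddP 8 5 (develop 9 6 [:: 0; 3] [:: [:: 49; 7; 25; 9; 20; 33; 43; 52; 24; 38;
    19; 5; 21; 34; 3; 44; 39; 48; 40; 1; 26; 45; 28; 18; 41; 29; 14; 4; 32; 51; 10; 16; 47; 22;
    31; 36; 2; 42; 11; 35; 0; 6; 53; 23; 17; 27; 30; 15; 13; 46; 8; 12; 50; 37]] [:: [:: 0; 20;
    52]; [:: 0; 53; 46]; [:: 0; 26; 22]; [:: 0; 32; 43]; [:: 0; 8; 16]; [:: 0; 44; 34]]));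
by vm_compute.
Qed.

Lemma rgdd6_10 : rgdd 10 6.
Proof.
apply: (@check_rgddP 9 5 (develop 9 6 [:: 0; 2; 4] [:: [:: 56; 48; 29; 47; 33; 18; 36; 20; 26;
    39; 59; 1; 46; 55; 13; 7; 51; 3; 22; 4; 37; 57; 8; 16; 35; 17; 38; 58; 27; 40; 9; 21; 14;
    52; 2; 32; 45; 25; 23; 53; 10; 30; 49; 44; 54; 12; 24; 11; 6; 19; 43; 42; 34; 5; 15; 41; 50;
    31; 0; 28]] [::]));
by vm_compute.
Qed.

Lemma rgdd6_12 : rgdd 12 6.
Proof.
apply: (@check_rgddP 11 5 (develop 11 6 [:: 0; 2; 4] [:: [:: 47; 52; 14; 31; 7; 26; 4; 35; 18;
    0; 56; 42; 9; 50; 27; 13; 64; 28; 63; 57; 44; 60; 38; 6; 68; 36; 43; 39; 53; 30; 62; 58; 12;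
    40; 49; 3; 15; 23; 71; 61; 20; 2; 46; 1; 37; 8; 45; 66; 11; 33; 48; 41; 19; 51; 69; 29; 54;
    10; 65; 70; 25; 59; 5; 22; 16; 55; 32; 24; 67; 17; 34; 21]] [::]));
by vm_compute.
Qed.

Lemma rgdd6_14 : rgdd 14 6.
Proof.
apply: (@check_rgddP 13 5 (develop 13 6 [:: 0; 2; 4] [:: [:: 52; 69; 5; 66; 47; 1; 44; 49; 3;
    18; 54; 50; 56; 8; 70; 10; 22; 42; 82; 72; 15; 80; 62; 41; 78; 28; 31; 21; 29; 33; 59; 73;
    17; 7; 63; 37; 26; 79; 19; 76; 83; 57; 60; 81; 11; 35; 53; 38; 13; 67; 34; 39; 45; 12; 61;
    16; 74; 27; 36; 64; 77; 32; 24; 2; 9; 20; 4; 23; 58; 0; 55; 6; 46; 71; 30; 48; 43; 14; 68;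
    51; 40; 25; 75; 65]] [::]));
by vm_compute.
Qed.

Lemma rgdd6_16 : rgdd 16 6.
Proof.
apply: (@check_rgddP 15 5 (develop 15 6 [:: 0; 2; 4] [:: [:: 50; 62; 88; 77; 43; 33; 80; 85; 71;
    53; 25; 31; 78; 29; 56; 42; 58; 92; 72; 82; 93; 54; 36; 12; 86; 79; 30; 27; 10; 69; 52; 94;
    59; 57; 68; 7; 32; 89; 16; 49; 26; 47; 55; 19; 28; 51; 65; 90; 83; 46; 40; 64; 41; 15; 4;
    23; 75; 45; 74; 66; 39; 63; 24; 67; 17; 22; 60; 34; 73; 20; 5; 70; 14; 84; 76; 11; 48; 18;
    6; 91; 37; 81; 21; 3; 35; 8; 61; 87; 1; 95; 2; 38; 13; 44; 9; 0]] [::]));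
by vm_compute.
Qed.

Lemma rgdd6_18 : rgdd 18 6.
Proof.
apply: (@check_rgddP 17 5 (develop 17 6 [:: 0; 2; 4] [:: [:: 103; 14; 61; 60; 68; 2; 65; 23;
    101; 98; 6; 75; 82; 8; 24; 48; 94; 77; 38; 0; 84; 40; 95; 44; 3; 9; 66; 31; 105; 36; 53; 7;
    19; 46; 80; 21; 58; 4; 34; 70; 56; 29; 47; 15; 54; 87; 39; 5; 59; 22; 49; 89; 51; 97; 33;
    86; 64; 88; 100; 11; 90; 96; 20; 55; 26; 45; 12; 32; 85; 43; 52; 107; 81; 72; 1; 42; 27; 99;
    62; 79; 102; 18; 17; 35; 63; 13; 28; 57; 41; 30; 25; 69; 10; 104; 91; 50; 83; 76; 16; 37;
    74; 106; 78; 93; 67; 71; 92; 73]] [::]));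
by vm_compute.
Qed.

(** Type [3^k] with [k] odd has [3 (k - 1) / 2] classes: the [k] rotations of a base class and
    [(k - 3) / 2] short classes. *)
Lemma rgdd3_3 : rgdd 3 3.
Proof.
apply: (@check_rgddP 2 2 (develop 3 3 [:: 0] [:: [:: 8; 3; 0; 5; 7; 2; 1; 6; 4]] [::]));
by vm_compute.
Qed.

Lemma rgdd3_7 : rgdd 7 3.
Proof.
apply: (@check_rgddP 6 2 (develop 7 3 [:: 0] [:: [:: 20; 5; 8; 12; 7; 11; 6; 9; 0; 2; 15; 13;
    17; 10; 3; 1; 14; 18; 19; 16; 4]] [:: [:: 0; 10; 5]; [:: 0; 13; 11]]));
by vm_compute.
Qed.

Lemma rgdd3_11 : rgdd 11 3.
Proof.
apply: (@check_rgddP 10 2 (develop 11 3 [:: 0] [:: [:: 26; 21; 20; 4; 8; 32; 12; 0; 18; 1; 11;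
    14; 13; 31; 19; 27; 7; 16; 28; 30; 25; 6; 3; 22; 23; 9; 5; 2; 15; 24; 29; 10; 17]] [:: [::
    0; 10; 8]; [:: 0; 7; 23]; [:: 0; 25; 17]; [:: 0; 4; 26]]));
by vm_compute.
Qed.

Lemma rgdd3_15 : rgdd 15 3.
Proof.
apply: (@check_rgddP 14 2 (develop 15 3 [:: 0] [:: [:: 26; 16; 8; 29; 39; 1; 23; 20; 32; 14; 25;
    40; 9; 38; 18; 42; 21; 15; 24; 28; 10; 17; 36; 3; 12; 44; 27; 0; 37; 13; 11; 41; 35; 2; 4;
    43; 6; 34; 5; 7; 33; 30; 19; 31; 22]] [:: [:: 0; 10; 41]; [:: 0; 43; 38]; [:: 0; 16; 23];
    [:: 0; 25; 5]; [:: 0; 34; 11]; [:: 0; 40; 8]]));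
by vm_compute.
Qed.

Lemma rgdd3_17 : rgdd 17 3.
Proof.
apply: (@check_rgddP 16 2 (develop 17 3 [:: 0] [:: [:: 7; 26; 50; 2; 8; 38; 34; 46; 23; 47; 30;
    25; 29; 17; 20; 27; 36; 13; 45; 9; 15; 48; 11; 16; 10; 4; 41; 5; 12; 0; 43; 28; 19; 40; 33;
    44; 32; 24; 14; 42; 18; 22; 6; 35; 3; 39; 37; 21; 1; 31; 49]] [:: [:: 0; 34; 50]; [:: 0; 40;
    47]; [:: 0; 10; 23]; [:: 0; 25; 35]; [:: 0; 13; 38]; [:: 0; 22; 20]; [:: 0; 43; 26]]));
by vm_compute.
Qed.

Lemma rgdd3_19 : rgdd 19 3.
Proof.
apply: (@check_rgddP 18 2 (develop 19 3 [:: 0] [:: [:: 25; 1; 53; 23; 50; 3; 8; 44; 9; 36; 11;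
    17; 37; 51; 49; 2; 20; 46; 21; 39; 54; 33; 45; 42; 41; 18; 24; 19; 13; 35; 15; 52; 55; 5;
    47; 7; 26; 29; 38; 28; 12; 43; 48; 4; 27; 56; 22; 32; 40; 31; 10; 30; 14; 0; 34; 16; 6]] [::
    [:: 0; 7; 50]; [:: 0; 49; 53]; [:: 0; 22; 11]; [:: 0; 19; 26]; [:: 0; 52; 44]; [:: 0; 25;
    5]; [:: 0; 46; 8]; [:: 0; 4; 29]]));
by vm_compute.
Qed.

Lemma rgdd3_23 : rgdd 23 3.
Proof.
apply: (@check_rgddP 22 2 (develop 23 3 [:: 0] [:: [:: 42; 39; 60; 35; 59; 0; 32; 9; 67; 55; 10;
    13; 14; 19; 40; 16; 47; 65; 38; 2; 33; 57; 22; 52; 45; 54; 21; 15; 43; 56; 4; 64; 58; 48; 6;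
    18; 31; 49; 63; 23; 34; 46; 66; 3; 28; 27; 12; 20; 53; 5; 44; 7; 68; 36; 29; 30; 26; 51; 25;
    61; 37; 41; 24; 8; 62; 50; 1; 11; 17]] [:: [:: 0; 61; 14]; [:: 0; 46; 29]; [:: 0; 4; 11];
    [:: 0; 19; 56]; [:: 0; 16; 44]; [:: 0; 7; 26]; [:: 0; 22; 47]; [:: 0; 52; 50]; [:: 0; 67;
    53]; [:: 0; 49; 20]]));
by vm_compute.
Qed.

(* The affine plane of order 3 without one point is a frame of type 2^4; its points are tripled. *)
Lemma frame6_4 : frame6 4.
Proof.
apply: (@check_frameP 3 [:: [:: [:: 6; 12; 21; 7; 13; 22; 8; 14; 23; 9; 18; 15; 10; 19; 16; 11;
    20; 17]; [:: 6; 13; 23; 7; 14; 21; 8; 12; 22; 9; 19; 17; 10; 20; 15; 11; 18; 16]; [:: 6; 14;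
    22; 7; 12; 23; 8; 13; 21; 9; 20; 16; 10; 18; 17; 11; 19; 15]]; [:: [:: 0; 12; 18; 1; 13; 19;
    2; 14; 20; 3; 21; 15; 4; 22; 16; 5; 23; 17]; [:: 0; 13; 20; 1; 14; 18; 2; 12; 19; 3; 22; 17;
    4; 23; 15; 5; 21; 16]; [:: 0; 14; 19; 1; 12; 20; 2; 13; 18; 3; 23; 16; 4; 21; 17; 5; 22;
    15]]; [:: [:: 6; 18; 3; 7; 19; 4; 8; 20; 5; 9; 0; 21; 10; 1; 22; 11; 2; 23]; [:: 6; 19; 5;
    7; 20; 3; 8; 18; 4; 9; 1; 23; 10; 2; 21; 11; 0; 22]; [:: 6; 20; 4; 7; 18; 5; 8; 19; 3; 9; 2;
    22; 10; 0; 23; 11; 1; 21]]; [:: [:: 6; 0; 15; 7; 1; 16; 8; 2; 17; 9; 12; 3; 10; 13; 4; 11;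
    14; 5]; [:: 6; 1; 17; 7; 2; 15; 8; 0; 16; 9; 13; 5; 10; 14; 3; 11; 12; 4]; [:: 6; 2; 16; 7;
    0; 17; 8; 1; 15; 9; 14; 4; 10; 12; 5; 11; 13; 3]]]);
by vm_compute.
Qed.

Lemma frame6_5 : frame6 5.
Proof.
apply: (@check_frameP 4 (develop_frame 5 [:: 6; 29; 17; 9; 16; 28; 19; 13; 11; 8; 23; 27; 12;
    26; 21; 14; 10; 20; 24; 22; 7; 15; 18; 25]));
by vm_compute.
Qed.

Lemma frame6_7 : frame6 7.
Proof.
apply: (@check_frameP 6 (develop_frame 7 [:: 40; 6; 33; 27; 15; 19; 18; 36; 16; 30; 37; 17; 10;
    24; 21; 38; 28; 34; 20; 7; 35; 11; 22; 39; 41; 23; 32; 25; 12; 31; 14; 9; 26; 29; 13; 8]));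
by vm_compute.
Qed.

(** Groups 0 to 4 are rotated and group 5 is fixed. Each class missing group 5 consists of the
    rotation orbits of two triangles. *)
Lemma frame6_6 : frame6 6.
Proof.
apply: (@check_frameP 5 (rcons (develop_frame 5 [:: 27; 31; 8; 26; 11; 17; 6; 29; 12; 24; 7; 32;
    14; 35; 22; 10; 28; 18; 21; 25; 13; 15; 30; 20; 19; 33; 9; 16; 23; 34]) [seq orbit_class 5 6
    [:: s] [:: 18; 27; 4; 5; 13; 8] | s <- [:: 0; 2; 4]]));
by vm_compute.
Qed.

(** * Twenty-four points *)

(** Here [s] is the concatenation of the cycles of a factor, and the table lists the successor of
    each point. *)
Definition cycle_table (m : nat) (s : seq nat) : seq nat :=
  [seq foldr (fun c r => if p \in c then next c p else r) p
     (reshape (nseq (size s %/ m) m) s) | p <- iota 0 (size s)].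

Definition check_orbits (v m : nat) (t : seq nat) : bool :=
  all (fun p => [&& nth 0 t p < v, iter m (nth 0 t) p == p
                  & all (fun j => iter j (nth 0 t) p != p) (iota 1 m.-1)]) (iota 0 v).

Definition check_hw (v : nat) (F : seq nat) (fs : seq (bool * seq nat)) : bool :=
  [&& check_orbits v 2 F, all (fun x => check_orbits v (if x.1 then 6 else 3) x.2) fs
    & all (fun p => all (fun q => (nth 0 F p == q) +
          sumn [seq (nth 0 x.2 p == q) + (nth 0 x.2 q == p) | x <- fs] == (p != q))
        (iota 0 v)) (iota 0 v)].

Lemma check_orbitsP v m t : 0 < m -> check_orbits v.+1 m t ->
  orbits_of_size m (fun x : 'I_v.+1 => inord (nth 0 t x) : 'I_v.+1).
Proof.
move=> m_gt0 /allP ct; have {}ct (x : 'I_v.+1) := ct x.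
have lt (x : 'I_v.+1) : nth 0 t x < v.+1.
  by have := ct x; rewrite mem_iota ltn_ord => /(_ isT)/and3P[].
have itE j (x : 'I_v.+1) :
    iter j (fun x : 'I_v.+1 => inord (nth 0 t x) : 'I_v.+1) x = iter j (nth 0 t) x :> nat.
  by elim: j => //= j IHj; rewrite inordK -?IHj.
move=> x; have := ct x; rewrite mem_iota ltn_ord => /(_ isT)/and3P[_ /eqP E /allP H].
split=> [|j jm]; first by apply: ord_inj; rewrite itE.
by apply: contra (H j _) => [/eqP Ej|]; [rewrite -itE Ej | rewrite mem_iota; lia].
Qed.

Lemma check_hwP v F fs : check_hw v.+1 F fs -> hw_decomposable 'I_v.+1 (count fst fs).
Proof.
case/and3P=> cF /allP cfs /allP sums.
pose tf (t : seq nat) (x : 'I_v.+1) : 'I_v.+1 := inord (nth 0 t x).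
have fsP (i : 'I_(size fs)) : nth (false, [::]) fs i \in fs by rewrite mem_nth.
have tfE m t (x y : 'I_v.+1) : check_orbits v.+1 m t -> (tf t x == y) = (nth 0 t x == y).
  move=> /allP ct; have := ct x; rewrite mem_iota ltn_ord => /(_ isT)/andP[lt _].
  by rewrite -(inj_eq (@ord_inj v.+1)) inordK.
exists (tf F), 'I_(size fs), (fun i : 'I_(size fs) => (nth (false, [::]) fs i).1).
exists (fun i : 'I_(size fs) => tf (nth (false, [::]) fs i).2); split.
- exact: check_orbitsP cF.
- by move=> i; apply: check_orbitsP (cfs _ (fsP i)); case: (nth _ _ _).1.
- move=> x y; have := sums x; rewrite mem_iota ltn_ord => /(_ isT)/allP/(_ y).
  rewrite mem_iota ltn_ord => /(_ isT)/eqP <-; rewrite (tfE _ _ _ _ cF); congr (_ + _).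
  rewrite sumnE big_map (big_nth (false, [::])) big_mkord.
  by apply: eq_bigr => i _; rewrite /nadj !(tfE _ _ _ _ (cfs _ (fsP i))).
- rewrite -sum1_count (big_nth (false, [::])) big_mkord -sum1_card.
  by apply: eq_bigl => i; rewrite unfold_in.
Qed.

Definition matching24 : seq nat := [seq if odd p then p.-1 else p.+1 | p <- iota 0 24].

(** Base class of a nearly Kirkman triple system of order 24: eleven of the pairs in [matching24]
    are rotated, the last one is fixed. *)
Definition nkts24_base : seq nat :=
  [:: 0; 19; 22; 1; 3; 18; 15; 11; 21; 23; 13; 4; 9; 17; 6; 8; 16; 7; 5; 12; 10; 2; 20; 14].

Lemma hw24_0 : hw_decomposable 'I_24 0.
Proof.
apply: (@check_hwP 23 matching24
  [seq (false, cycle_table 3 (image_class 11 2 u 0 nkts24_base)) | u <- iota 0 11]).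
by vm_compute.
Qed.

(* The class [nkts24_base] and [matching24] together form a cubic graph, which is split here
   into hexagons and another perfect matching. *)
Lemma hw24_1 : hw_decomposable 'I_24 1.
Proof.
apply: (@check_hwP 23
  [:: 19; 18; 3; 2; 13; 12; 7; 6; 16; 17; 11; 10; 5; 4; 20; 21; 8; 9; 1; 0; 14; 15; 23; 22]
  ((true, cycle_table 6
     [:: 0; 1; 3; 18; 19; 22; 2; 20; 21; 11; 15; 14; 4; 5; 10; 12; 13; 23; 6; 9; 8; 7; 16; 17])
   :: [seq (false, cycle_table 3 (image_class 11 2 u 0 nkts24_base)) | u <- iota 1 10])).
by vm_compute.
Qed.

Lemma hw24_11 : hw_decomposable 'I_24 11.
Proof.
apply: (@check_hwP 23 matching24
  [seq (true, cycle_table 6 (image_class 11 2 u 0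
     [:: 9; 19; 15; 18; 10; 17; 8; 11; 16; 20; 7; 13; 3; 14; 4; 23; 5; 12; 21; 22; 6; 0; 2; 1]))
  | u <- iota 0 11]).
by vm_compute.
Qed.

(** * Existence for all orders *)

Lemma frame6_small m : m \in [:: 0; 1; 4; 5; 6; 7] -> frame6 m.
Proof.
rewrite !inE; repeat case/orP; move/eqP->;
  solve [exact: frame6_le1 | exact: frame6_4 | exact: frame6_5 | exact: frame6_6 | exact: frame6_7].
Qed.

Lemma rgdd6_truncated (n : nat) (ts : seq nat) :
  all (fun d => coprime n d) (iota 1 (size ts).-2) -> all (fun t => t <= n) ts ->
  (forall a s, a < n -> s < n ->
     count (fun j => n - nth 0 ts j <= line n a s j) (iota 0 (size ts))
       \in [:: 0; 1; 4; 5; 6; 7]) ->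
  (forall t, t \in ts -> rgdd6 t.+1) ->
  rgdd6 (sumn ts).+1.
Proof.
move=> /allP co /allP tn Fr R; rewrite sumnE (big_nth 0) big_mkord.
apply: (truncated_TD (n := n)) => [d dg|j jg|a s an sn|j jg].
- by apply: co; rewrite mem_iota; lia.
- by apply/tn/mem_nth.
- exact/frame6_small/Fr.
- exact/R/mem_nth.
Qed.

(** Every line meets the four full groups and at most three truncated ones, so it keeps between 4
    and 7 points. *)
Lemma rgdd6_four_full (n : nat) (tl : seq nat) :
  size tl <= 3 -> all (fun d => coprime n d) (iota 1 (size tl + 2)) ->
  all (fun t => t <= n) tl -> rgdd6 n.+1 -> (forall t, t \in tl -> rgdd6 t.+1) ->
  rgdd6 (4 * n + sumn tl).+1.
Proof.
move=> tl3 co tn Rn R.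
have -> : 4 * n + sumn tl = sumn [:: n, n, n, n & tl] by rewrite /=; lia.
apply: (@rgdd6_truncated n) => [||a s an sn|t].
- by move: co; rewrite addn2.
- by rewrite /= !leqnn.
- set P := (fun j => _); have -> : count P (iota 0 (size [:: n, n, n, n & tl])) =
      4 + count P (iota 4 (size tl)).
    have full j : j < 4 -> P j by case: j => [|[|[|[|//]]]] _; rewrite /P /= subnn.
    by rewrite /= !full.
  have := leq_trans (count_size P (iota 4 (size tl))) (eq_leq (size_iota _ _)).
  by move: (count _ _) => c c_le; have := leq_trans c_le tl3; case: c {c_le} => [|[|[|[|]]]].
- by rewrite !inE => /or4P[/eqP->|/eqP->|/eqP->|/orP[/eqP->|/R]].
Qed.

(* The excluded values above 3 are only those that the recursion and the listed designs miss. *)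
Definition constructed (k : nat) : bool := (3 < k) && (k \notin [:: 7; 11; 15; 17; 19; 23]).

(** Entry [i] gives the order [n] and the sizes of the truncated groups for [k = 24 + i]. *)
Definition tail_table : seq (nat * seq nat) :=
  [:: (5, [:: 3]); (5, [:: 4]); (5, [:: 5]); (5, [:: 3; 3]); (5, [:: 4; 3]); (7, [::]);
      (5, [:: 5; 4]); (5, [:: 5; 5]); (7, [:: 3]); (7, [:: 4]); (7, [:: 5]); (7, [:: 3; 3]);
      (7, [:: 7]); (7, [:: 5; 3]); (7, [:: 5; 4]); (7, [:: 7; 3]); (7, [:: 7; 4]);
      (7, [:: 7; 5]); (7, [:: 7; 3; 3]); (7, [:: 7; 7]); (7, [:: 7; 5; 3]); (11, [::]);
      (7, [:: 7; 7; 3]); (7, [:: 7; 7; 4]); (11, [:: 3]); (11, [:: 4]); (11, [:: 5]);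
      (11, [:: 3; 3]); (11, [:: 7]); (13, [::]); (11, [:: 9]); (11, [:: 7; 3]);
      (11, [:: 11]); (13, [:: 4]); (13, [:: 5]); (11, [:: 11; 3]); (13, [:: 7]);
      (13, [:: 8]); (13, [:: 9]); (11, [:: 11; 7]); (13, [:: 11]); (13, [:: 12]);
      (13, [:: 13]); (11, [:: 11; 11]); (13, [:: 12; 3]); (13, [:: 13; 3]);
      (13, [:: 13; 4]); (13, [:: 13; 5])].

Definition valid_tail (k n : nat) (tl : seq nat) : bool :=
  [&& k == (4 * n + sumn tl).+1, size tl <= 3, all (fun d => coprime n d) (iota 1 (size tl + 2)),
      all (fun t => t <= n) tl, 0 < n, constructed n.+1 & all (fun t => constructed t.+1) tl].

Lemma tail_tableP k : 24 <= k < 72 -> exists n tl, valid_tail k n tl.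
Proof.
move=> Hk; have /allP/(_ k) : all (fun k => let x := nth (0, [::]) tail_table (k - 24) in
    valid_tail k x.1 x.2) (iota 24 48) by vm_compute.
rewrite mem_iota Hk => /(_ isT); case: (nth _ _ _) => n tl /= H.
by exists n, tl.
Qed.

(** Tails of at most two groups only require [n] to be prime to 1, 2, 3 and 4. *)
Lemma coprime_mod6 n d : n %% 6 \in [:: 1; 5] -> 0 < d < 5 -> coprime n d.
Proof.
rewrite !inE => n6 d5.
have c2 : coprime n 2 by rewrite coprimen2; lia.
have c3 : coprime n 3 by rewrite coprime_sym prime_coprime //; lia.
case: d d5 => [|[|[|[|[|d]]]]] //= _; first by rewrite coprimen1.
by rewrite (coprimeMr n 2 2) c2.
Qed.

Lemma valid_tail_exists k : 72 <= k -> exists n tl, valid_tail k n tl.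
Proof.
move=> k72.
have [n [n6 kn nk]] : exists n, [/\ n %% 6 \in [:: 1; 5], 4 * n + 4 <= k & k <= 5 * n + 1].
  case: (leqP k 86) => k86; first by exists 17; split=> //; lia.
  case: (leqP k 90) => k90; first by exists 19; split=> //; lia.
  have : exists2 n, n %% 6 \in [:: 1; 5] & n <= (k - 4) %/ 4 <= n + 3.
    pose m := (k - 4) %/ 4; rewrite -/m; have m_gt5 : 5 < m by rewrite /m; lia.
    have : m %% 6 < 6 by rewrite ltn_mod.
    case E: (m %% 6) => [|[|[|[|[|[|//]]]]]] _;
      [exists (m - 1) | exists m | exists (m - 1) | exists (m - 2) | exists (m - 3) | exists m];
      rewrite ?inE; lia.
  by case=> n n6 /andP[nm mn]; exists n; split=> //; lia.
have n_gt0 : 14 < n by lia.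
(* As [n] is odd, [n + 1] is even, while all excluded values above 3 are odd. *)
have nG : constructed n.+1.
  by move: n6; rewrite /constructed !inE => n6; apply/andP; split; lia.
have co b : b <= 2 -> all (fun d => coprime n d) (iota 1 (b + 2)).
  by move=> b2; apply/allP => d; rewrite mem_iota => db; apply: coprime_mod6 => //; lia.
pose t := k - 1 - 4 * n.
have [tG|tB] := boolP (constructed t.+1).
  exists n, [:: t]; apply/and5P; split; rewrite ?(co 1) //= ?tG ?nG /t; lia.
(* Now [t + 1] is one of the six excluded values, and lowering it by 3 gives 4, 8, 12, 14, 16 or 20,
   which are all admissible. *)
exists n, [:: t - 3; 3]; move: tB; rewrite /constructed !inE negb_and negbK /t => tB.
by apply/and5P; split; rewrite ?(co 2) //= ?nG /constructed ?inE; lia.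
Qed.

Lemma constructed_rgdd6 k : constructed k -> rgdd6 k.
Proof.
have [m] := ubnP k; elim: m k => // m IHm k km Gk.
have step n tl : valid_tail k n tl -> rgdd6 k.
  case/and5P=> /eqP Ek tl3 co tn /and3P[n0 Gn /allP Gt]; rewrite Ek.
  apply: rgdd6_four_full => //; first by apply: IHm => //; lia.
  move=> t ttl; apply: IHm (Gt t ttl); move/allP: tn => tn; have := tn t ttl; lia.
case: (leqP 72 k) => k72; first by have [n [tl /step]] := valid_tail_exists k72.
case: (leqP 24 k) => k24.
  by have [|n [tl /step //]] := @tail_tableP k; rewrite k24.
have R n : constructed n -> n < k -> rgdd6 n by move=> Gn nk; apply: IHm => //; lia.
(* Used for [k] = 13, 20, 21 and 22, where the sizes of all truncated lines are checked by
   enumeration. *)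
have special n ts : k = (sumn ts).+1 ->
    all (fun d => coprime n d) (iota 1 (size ts).-2) && all (fun t => t <= n) ts ->
    all (fun a => all (fun s =>
      count (fun j => n - nth 0 ts j <= line n a s j) (iota 0 (size ts)) \in [:: 0; 1; 4; 5; 6; 7])
      (iota 0 n)) (iota 0 n) ->
    all (fun t => constructed t.+1) ts && all (fun t => t.+1 < k) ts -> rgdd6 k.
  move=> Ek /andP[co tn] /allP Fr /andP[/allP Gt /allP tk]; rewrite {1}Ek.
  apply: (rgdd6_truncated co tn) => [a s an sn|t tin]; last by apply: R; [apply: Gt | apply: tk].
  by have := Fr a; rewrite mem_iota an => /(_ isT)/allP/(_ s); rewrite mem_iota sn => /(_ isT).
move: R special Gk; clear -k24; move: k k24.
do 24 (case; [move=> _ R special Gk;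
  solve [ by [] | exact: rgdd6_4 | exact: rgdd6_5 | exact: rgdd6_6 | exact: rgdd6_8 | exact: rgdd6_9
        | exact: rgdd6_10 | exact: rgdd6_12 | exact: rgdd6_14 | exact: rgdd6_16 | exact: rgdd6_18
        | by apply: (special 3 [:: 3; 3; 3; 3])
        | by apply: (special 5 [:: 4; 3; 3; 3; 3; 3])
        | by apply: (special 5 [:: 5; 5; 5; 5])
        | by apply: (special 5 [:: 5; 4; 4; 4; 4]) ] |]).
by [].
Qed.

Lemma hw_24 (k s : nat) : 2 < k -> s < 12 * k -> hw_decomposable 'I_(24 * k) s.
Proof.
move=> k2 sk.
have h24 j : j \in [:: 0; 1; 11] -> hw_decomposable 'I_24 j.
  by rewrite !inE => /or3P[] /eqP ->; [exact: hw24_0 | exact: hw24_1 | exact: hw24_11].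
have [Gk|Bk] := boolP (constructed k).
  have [I [f fP]] := constructed_rgdd6 Gk.
  apply: (@hw_decomposable_card ('I_k * 'I_6 * (bool * bool))%type).
    by rewrite !card_prod !card_ord card_bool; lia.
  by apply: (hw_of_groups fP liftable_klein); rewrite ?card_prod ?card_ord ?card_bool.
have [I [f fP]] : rgdd k 3.
  move: Bk; rewrite /constructed negb_and negbK -leqNgt => /orP[k3|].
    have -> : k = 3 by lia.
    exact: rgdd3_3.
  rewrite !inE; repeat case/orP; move/eqP->;
    solve [exact: rgdd3_7 | exact: rgdd3_11 | exact: rgdd3_15 | exact: rgdd3_17
          | exact: rgdd3_19 | exact: rgdd3_23].
apply: (@hw_decomposable_card ('I_k * 'I_3 * (bool * bool * bool))%type).
  by rewrite !card_prod !card_ord card_bool; lia.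
by apply: (hw_of_groups fP liftable_cube); rewrite ?card_prod ?card_ord ?card_bool.
Qed.

Theorem theorem23 (y r s : nat) (y_gt0 : 0 < y) (y_mod4 : y = 0 %[mod 4]) :
  (HWP 3 6 (6 * y) r s -> r + s = (6 * y - 2) %/ 2) /\
  (r + s = (6 * y - 2) %/ 2 -> y <> 4 -> y <> 8 -> HWP 3 6 (6 * y) r s).
Proof.
have v0 : 0 < 6 * y by lia.
have ve : ~~ odd (6 * y) by rewrite oddM.
split=> [|rs y4 y8]; first exact: HWP_count.
apply: hw_decomposable_HWP => //.
(* With [k = y / 4], the excluded [y = 4] and [y = 8] are [k = 1] and [k = 2], and the sum [r + s]
   is [12 k - 1], so [s < 12 k]. *)
apply: (@hw_decomposable_card 'I_(24 * (y %/ 4))); first by rewrite !card_ord; lia.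
by apply: hw_24; lia.
Qed.
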